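(* Let $R$ be a commutative Noetherian ring. Then the following are equivalent. (1) $R$ is almost-$QF$. (2) $R$ is max-$QF$. (3) $R=A\times B$ (as rings), where $A$ is a $QF$ ring and $B$ is a small ring.
   Context: Rings are associative with identity; modules are unital. An $R$-module $M$ is $R$-projective if for every ideal $I$ of $R$, every homomorphism $M\to R/I$ factors through the canonical projection $R\to R/I$; it is max-projective if this holds for every maximal ideal $I$. A ring $R$ is almost-$QF$ (resp. max-$QF$) if every injective $R$-module is $R$-projective (resp. max-projective). A ring is $QF$ (quasi-Frobenius) if and only if every injective module over it is projective. A submodule $K$ of $M$ is superfluous, written $K\ll M$, if $K+L\neq M$ for every proper submodule $L$ of $M$. $R$ is a small ring if $R\ll E(R)$, where $E(R)$ is the injective hull of the module $R$. In the product decomposition a factor is allowed to be the zero ring. *)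

(* Defs.v *)
From HB Require Import structures.
From mathcomp Require Import all_boot all_algebra.
From mathcomp Require Import boolp.

Set Implicit Arguments.
Unset Strict Implicit.
Unset Printing Implicit Defensive.

Import GRing.Theory.
Local Open Scope ring_scope.
Local Open Scope quotient_scope.

(* Rings are [pzRingType]s: unlike [nzRingType], this allows the zero ring.   *)
(* A submodule of V is a [submodClosed V]; such predicates are boolean, but   *)
(* every Prop-valued predicate P gives one, x |-> `[< P x >].                 *)

Section SubmoduleQuotient.
Variables (R : pzRingType) (V : lmodType R) (N : submodClosed V).

(* [SubmodClosed] inherits from [AddClosed] only; closure under opposites,    *)
(* needed by [Quotient.quot], has to be added.                                *)
Definition submod_pred : {pred V} := fun x => x \in N.

Lemma submod_zmod_closed : zmod_closed submod_pred.
Proof. exact: GRing.submod_closedB (submodClosedP N). Qed.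

HB.instance Definition _ :=
  GRing.isZmodClosed.Build V submod_pred submod_zmod_closed.

Definition quotmod : Type := Quotient.quot submod_pred.

HB.instance Definition _ := GRing.Zmodule.on quotmod.

Definition quotmod_proj (x : V) : quotmod :=
  \pi_(Quotient.quot submod_pred) x.

Lemma quotmod_projP x y : quotmod_proj x = quotmod_proj y <-> x - y \in N.
Proof.
rewrite (_ : (x - y \in N) = (x - y \in submod_pred)) //.
by rewrite Quotient.idealrBE; split=> [xy|/eqP //]; apply/eqP.
Qed.

Lemma quotmod_proj_surj (q : quotmod) : exists x, quotmod_proj x = q.
Proof. by exists (repr q); apply: reprK. Qed.

Lemma quotmod_projB : {morph quotmod_proj : x y / x - y}.
Proof. exact: pi_is_zmod_morphism. Qed.

Definition quotmod_scale (a : R) (q : quotmod) : quotmod :=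
  quotmod_proj (a *: repr q).

Lemma quotmod_scaleE a x :
  quotmod_scale a (quotmod_proj x) = quotmod_proj (a *: x).
Proof.
apply/quotmod_projP; rewrite -scalerBr rpredZ //.
by apply/quotmod_projP; apply: reprK.
Qed.

HB.instance Definition _ :=
  GRing.isZmodMorphism.Build V quotmod quotmod_proj quotmod_projB.

Lemma quotmod_scalerA a b q :
  quotmod_scale a (quotmod_scale b q) = quotmod_scale (a * b) q.
Proof.
by have [x <-] := quotmod_proj_surj q; rewrite !quotmod_scaleE scalerA.
Qed.

Lemma quotmod_scale1r : left_id 1 quotmod_scale.
Proof.
by move=> q; have [x <-] := quotmod_proj_surj q; rewrite quotmod_scaleE scale1r.
Qed.

Lemma quotmod_scalerDr : right_distributive quotmod_scale +%R.
Proof.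
move=> a p q; have [x <-] := quotmod_proj_surj p.
have [y <-] := quotmod_proj_surj q.
by rewrite -raddfD !quotmod_scaleE scalerDr raddfD.
Qed.

Lemma quotmod_scalerDl q : {morph quotmod_scale^~ q : a b / a + b}.
Proof.
move=> a b; have [x <-] := quotmod_proj_surj q.
by rewrite /= !quotmod_scaleE scalerDl raddfD.
Qed.

HB.instance Definition _ := GRing.Zmodule_isLmodule.Build R quotmod
  quotmod_scalerA quotmod_scale1r quotmod_scalerDr quotmod_scalerDl.

Lemma quotmod_proj_scalable : scalable quotmod_proj.
Proof. by move=> a x; rewrite -quotmod_scaleE. Qed.

HB.instance Definition _ :=
  GRing.isScalable.Build R V quotmod *:%R quotmod_proj quotmod_proj_scalable.

End SubmoduleQuotient.

Section LinearImage.
Variables (R : pzRingType) (U V : lmodType R) (f : {linear U -> V}).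

Definition limage : {pred V} := fun y => `[< exists x, f x = y >].

Lemma limage_submod_closed : submod_closed limage.
Proof.
split=> [|a u v /asboolP[x <-] /asboolP[y <-]]; apply/asboolP.
  by exists 0; rewrite linear0.
by exists (a *: x + y); rewrite linearP.
Qed.

HB.instance Definition _ :=
  GRing.isSubmodClosed.Build R V limage limage_submod_closed.

End LinearImage.

Section Modules.
Variable R : pzRingType.

Definition injective_module (E : lmodType R) : Prop :=
  forall (N M : lmodType R) (i : {linear N -> M}) (f : {linear N -> E}),
    injective i -> exists g : {linear M -> E}, forall x, g (i x) = f x.

Definition projective_module (P : lmodType R) : Prop :=
  forall (M N : lmodType R) (p : {linear M -> N}) (f : {linear P -> N}),
    (forall y, exists x, p x = y) ->
    exists g : {linear P -> M}, forall x, p (g x) = f x.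

Definition superfluous (M : lmodType R) (K : submodClosed M) : Prop :=
  forall L : submodClosed M, ~ (forall x, x \in L) ->
    ~ (forall x, exists y z, [/\ y \in K, z \in L & x = y + z]).

Definition essential (M : lmodType R) (K : submodClosed M) : Prop :=
  forall L : submodClosed M,
    (forall x, x \in K -> x \in L -> x = 0) -> forall x, x \in L -> x = 0.

Definition injective_hull (M E : lmodType R) (i : {linear M -> E}) : Prop :=
  [/\ injective i, injective_module E & essential (limage i)].

End Modules.

Section Rings.
Variable R : comPzRingType.

(* The ideals of R are the submodules of the regular module [R^o]; the unit   *)
(* ideal is included, unlike in the library's [idealr].                       *)
Definition ideal := submodClosed R^o.

Definition noetherian : Prop :=
  forall I : nat -> ideal, (forall n, {subset I n <= I n.+1}) ->
    exists n, forall m, (n <= m)%N -> I m =i I n.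

Definition maximal_ideal (I : ideal) : Prop :=
  ~ (forall x, x \in I) /\
  forall J : ideal, {subset I <= J} -> J =i I \/ (forall x, x \in J).

Definition factors_through_proj (M : lmodType R) (I : ideal) : Prop :=
  forall f : {linear M -> quotmod I},
    exists g : {linear M -> R^o}, forall x, quotmod_proj I (g x) = f x.

Definition R_projective (M : lmodType R) : Prop :=
  forall I : ideal, factors_through_proj M I.

Definition max_projective (M : lmodType R) : Prop :=
  forall I : ideal, maximal_ideal I -> factors_through_proj M I.

Definition almost_QF : Prop :=
  forall M : lmodType R, injective_module M -> R_projective M.

Definition max_QF : Prop :=
  forall M : lmodType R, injective_module M -> max_projective M.

Definition quasi_Frobenius : Prop :=
  forall M : lmodType R, injective_module M -> projective_module M.

(* E(R) is determined up to isomorphism over R, so any hull will do.          *)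
Definition small_ring : Prop :=
  exists (E : lmodType R) (i : {linear R^o -> E}),
    injective_hull i /\ superfluous (limage i).

End Rings.

(* Main.v *)
Require Import Defs.
From HB Require Import structures.
From mathcomp Require Import all_boot all_algebra.
From mathcomp Require Import boolp classical_sets.

(** Passing from almost-QF to max-QF is a specialization; the content lies in
    the two other implications.

    From max-QF to a decomposition. Let m be a maximal ideal with m s = 0 for
    some s <> 0, let E be the injective hull of R/m and y a generator of R/m
    inside E. As R s and R y are both isomorphic to R/m, injectivity gives z in
    E with s z = y, and multiplication by s maps E onto R y, because s E is
    killed by m. Viewed as a map E -> R/m, it lifts to g : E -> R with g z = 1
    modulo m, so g y = s (g z) = s. Since E is essential over R y and s <> 0, g
    is injective, and E becomes a direct summand e R of R which contains s
    ([simple_ideal_hull]). By a Fitting argument the elements of m are nilpotent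
    on e R, so m is the only prime ideal which does not contain e
    ([simple_ideal_idempotent]).

    The ascending chain condition then yields a largest e R among the
    idempotents e such that every prime not containing e is maximal and has a
    nonzero annihilator ([maximal_socular_idempotent]). By maximality no maximal
    ideal n of B = (1 - e) R has a nonzero annihilator. As n is finitely
    generated, this forces n Q = Q for every injective Q, so Q has no simple
    quotient, and B is small ([small_criterion]). Over A = e R, an associated
    prime of a nonzero injective module Q is maximal and kills a nonzero element
    s of A, so Q contains the hull of the simple ideal A s, which is injective
    and also a direct summand of A. Splitting off such pieces one after the
    other shows that Q is projective: Zorn's lemma is applied to the partial
    liftings of a map which are defined on an injective submodule, unions of
    chains of injective submodules being injective over a Noetherian ring
    ([QF_criterion]).

    From a decomposition R = A x B to almost-QF. Let M be an injective R-module.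
    The A-part of M is injective over A, hence projective, so its maps to R/I
    lift to R. The B-part has no nonzero map to R/I: a nonzero one has a
    Noetherian image, hence gives a maximal submodule L of that part; for x
    outside L, the map b |-> b x extends from B to k : E(B) -> M, and the
    preimage of L under k is a proper submodule whose sum with B is E(B),
    against smallness ([small_factor_map0]).

    Partial linear maps are treated as functional linear relations, so that
    Zorn's lemma applies to their graphs. Injective hulls are found inside
    powers of the module of additive maps from R to Q/Z. *)

Set Implicit Arguments.
Unset Strict Implicit.
Unset Printing Implicit Defensive.

Import GRing.Theory Num.Theory.
Local Open Scope ring_scope.

(** * Submodules given by Prop-valued predicates *)

Definition is_submodule (R : pzRingType) (V : lmodType R) (S : V -> Prop) :=
  S 0 /\ forall a u v, S u -> S v -> S (a *: u + v).

Section SubmoduleOfSet.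
Variables (R : pzRingType) (V : lmodType R) (S : V -> Prop).
Hypothesis submodS : is_submodule S.

Definition submodule_of & is_submodule S : {pred V} := fun x => `[< S x >].

Lemma submodule_of_closed : submod_closed (submodule_of submodS).
Proof.
case: submodS => S0 SP; split=> [|a u v /asboolP Su /asboolP Sv].
  exact/asboolP.
by apply/asboolP; apply: SP.
Qed.

HB.instance Definition _ :=
  GRing.isSubmodClosed.Build R V (submodule_of submodS) submodule_of_closed.

Lemma in_submodule_of x : x \in submodule_of submodS <-> S x.
Proof. by split=> /asboolP. Qed.

End SubmoduleOfSet.

Section SubmoduleType.
Variables (R : pzRingType) (V : lmodType R) (N : submodClosed V).

Definition submodule_type : Type := {x : V | x \in N}.
HB.instance Definition _ := [isSub of submodule_type for @sval _ _].
HB.instance Definition _ := [Choice of submodule_type by <:].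
HB.instance Definition _ := [SubChoice_isSubLmodule of submodule_type by <:].

End SubmoduleType.

(** * Linear relations *)

Lemma linear_exists (R : pzRingType) (V W : lmodType R) (f : V -> W) :
  linear f -> exists g : {linear V -> W}, g =1 f.
Proof.
move=> lin_f.
pose F := GRing.isLinear.Build R V W *:%R f lin_f.
pose g : {linear V -> W} := HB.pack f F.
by exists g.
Qed.

Section LinearRelation.
Variables (R : pzRingType) (V W : lmodType R).

(** Linear relations are the submodules of V x W; the functional ones are the
    graphs of linear maps defined on a submodule of V. *)
Definition linear_rel (T : V -> W -> Prop) :=
  T 0 0 /\ forall a x y x' y',
    T x y -> T x' y' -> T (a *: x + x') (a *: y + y').

Definition functional_rel (T : V -> W -> Prop) := forall y, T 0 y -> y = 0.

Lemma linear_relB T x y x' y' :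
  linear_rel T -> T x y -> T x' y' -> T (x - x') (y - y').
Proof.
by move=> [_ TP] Txy Tx'y'; have := TP (-1) _ _ _ _ Tx'y' Txy;
  rewrite !scaleN1r ![- _ + _]addrC.
Qed.

Lemma linear_relZ T a x y : linear_rel T -> T x y -> T (a *: x) (a *: y).
Proof. by move=> [T0 TP] Txy; have := TP a _ _ _ _ Txy T0; rewrite !addr0. Qed.

Lemma functional_rel_eq T x y y' :
  linear_rel T -> functional_rel T -> T x y -> T x y' -> y = y'.
Proof.
move=> linT funT Txy Txy'; apply/eqP; rewrite -subr_eq0; apply/eqP/funT.
by rewrite -(subrr x); apply: linear_relB.
Qed.

Lemma linear_rel_total T :
  linear_rel T -> functional_rel T -> (forall x, exists y, T x y) ->
  exists g : {linear V -> W}, forall x, T x (g x).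
Proof.
move=> linT funT /choice[f Tf].
have [a u v|g gf] := @linear_exists R V W f.
  apply: (functional_rel_eq linT funT (Tf _)).
  by case: linT => _; apply.
by exists g => x; rewrite gf.
Qed.

End LinearRelation.

Lemma linear_lift (R : pzRingType) (U V W : lmodType R)
    (i : {linear V -> W}) (h : {linear U -> W}) :
  injective i -> (forall x, exists y, i y = h x) ->
  exists f : {linear U -> V}, forall x, i (f x) = h x.
Proof.
move=> inj_i; apply: (@linear_rel_total _ _ _ (fun x y => i y = h x)).
  split=> [|a x y x' y' e e']; first by rewrite !linear0.
  by rewrite !linearP e e'.
by move=> y; rewrite linear0 -(linear0 i) => /inj_i.
Qed.

(** * Zorn's lemma and Baer's criterion *)

Lemma Zorn_above (W : Type) (P : set W -> Prop) (S0 : set W) :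
  P S0 ->
  (forall C : set (set W), (forall X, C X -> P X) -> total_on C subset ->
     (exists X, C X) -> P (\bigcup_(X in C) X)%classic) ->
  exists S, [/\ P S, subset S0 S & forall S', subset S S' -> P S' -> S' = S].
Proof.
move=> PS0 chainP.
have [F FP totF|S [PS maxS]] := @Zorn_bigcup W (fun X => P (S0 `|` X)%classic).
  have [FX|noF] := pselect (exists X, F X).
    have [X0 FX0] := FX.
    rewrite (_ : (_ `|` _)%classic =
      (\bigcup_(Y in [set S0 `|` X | X in F]) Y)%classic); last first.
      apply/predeqP => w; split=> [[S0w|[X FX' Xw]]|[_ [X FX' <-] [S0w|Xw]]].
      - by exists (S0 `|` X0)%classic; [exists X0|left].
      - by exists (S0 `|` X)%classic; [exists X|right].
      - by left.
      - by right; exists X.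
    apply: chainP => [_ [X FX' <-]|_ _ [X FX' <-] [Y FY <-]|].
    - exact: FP.
    - by case: (totF _ _ FX' FY) => sXY; [left|right]; apply: setUS.
    - by exists (S0 `|` X0)%classic; exists X0.
  rewrite (_ : (_ `|` _)%classic = S0) //.
  apply/predeqP => w; split=> [[//|[X FX]]|]; last by left.
  by case: noF; exists X.
exists (S0 `|` S)%classic; split=> [//|w S0w|S' sSS' PS']; first by left.
apply: contrapT => neS.
apply: (maxS S'); last by rewrite (_ : (_ `|` _)%classic = S') //;
  apply/predeqP=> w; split=> [[S0w|//]|]; [apply: sSS'; left|right].
split=> [w Sw|sS'S]; first by apply: sSS'; right.
by apply: neS; apply/predeqP => w; split=> [/sS'S|/sSS' //]; right.
Qed.

Lemma bigcup_submodule (R : pzRingType) (V : lmodType R) (C : set (set V)) :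
  (forall X, C X -> is_submodule X) -> total_on C subset -> (exists X, C X) ->
  is_submodule (\bigcup_(X in C) X)%classic.
Proof.
move=> subC totC [X0 CX0].
split=> [|a u v [X CX Xu] [Y CY Yv]].
  by exists X0 => //; case: (subC _ CX0).
have [sXY|sYX] := totC _ _ CX CY.
  by exists Y => //; case: (subC _ CY) => _; apply => //; apply: sXY.
by exists X => //; case: (subC _ CX) => _; apply => //; apply: sYX.
Qed.

Lemma linear_rel_graph (R : pzRingType) (V W : lmodType R) (G : set (V * W)) :
  linear_rel (fun x y => G (x, y)) <-> is_submodule G.
Proof.
by split=> -[G0 GP]; split=> // a; [move=> [x y] [x' y']|move=> x y x' y'];
  apply: GP.
Qed.

Section Baer.
Variables (R : pzRingType) (E : lmodType R).

(** Baer's condition: a linear map from an ideal of R to E, encoded as a linear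
    relation, is given by the multiples of an element of E. *)
Definition Baer_injective :=
  forall T : R^o -> E -> Prop, linear_rel T -> functional_rel T ->
  exists y : E, forall (r : R) z, T r z -> z = r *: y.

(** A maximal extension G of the partial map T0 is total: Baer's condition for
    the ideal of those r such that r v lies in the domain of G says which value
    at v is compatible with G. *)
Lemma Baer_extension (V : lmodType R) (T0 : V -> E -> Prop) :
  Baer_injective -> linear_rel T0 -> functional_rel T0 ->
  exists g : {linear V -> E}, forall x y, T0 x y -> g x = y.
Proof.
move=> baerE linT0 funT0.
pose P (G : set (V * E)) :=
  linear_rel (fun x y => G (x, y)) /\ functional_rel (fun x y => G (x, y)).
have [|C CP totC [X0 CX0]|G [[linG funG] sT0G maxG]] :=
    @Zorn_above _ P (fun w => T0 w.1 w.2).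
- by split.
- split; last by move=> y [X /CP[_ funX] /funX].
  apply/linear_rel_graph/bigcup_submodule => //; last by exists X0.
  by move=> X /CP[/linear_rel_graph].
have totG v : exists y, G (v, y).
  (* Baer's hypothesis for the ideal of the r with r *: v in the domain *)
  have [||y yP] := baerE (fun (r : R) z => G (r *: v, z)).
  - split=> [|a r z r' z' Gz Gz']; first by rewrite scale0r; case: linG.
    by rewrite scalerDl -scalerA; case: linG => _; apply.
  - by move=> z; rewrite scale0r; apply: funG.
  pose G' : set (V * E) :=
    fun w => exists x z r, G (x, z) /\ w = (x + r *: v, z + r *: y).
  have G'G : G' = G.
    apply: maxG => [[x z] Gxz|].
      by exists x, z, 0; rewrite !scale0r !addr0.
    split; first split.
    - by exists 0, 0, 0; rewrite !scale0r !addr0; case: linG.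
    - move=> a _ _ _ _ [x [z [r [Gxz [-> ->]]]]] [x' [z' [r' [Gxz' [-> ->]]]]].
      exists (a *: x + x'), (a *: z + z'), (a * r + r'); split.
        by case: linG => _; apply.
      by congr pair; rewrite scalerDr !scalerDl scalerA addrACA.
    - move=> _ [x [z [r [Gxz [/esym/eqP + ->]]]]].
      rewrite addr_eq0 => /eqP xE; rewrite xE -scaleNr in Gxz.
      by rewrite (yP _ _ Gxz) scaleNr addNr.
  exists y; rewrite -G'G; exists 0, 0, 1; rewrite !scale1r !add0r.
  by case: linG.
have [g gP] := linear_rel_total linG funG totG.
exists g => x y T0xy; apply: (functional_rel_eq linG funG (gP x)).
exact: (sT0G (x, y)).
Qed.

Lemma Baer_injective_module : Baer_injective -> injective_module E.
Proof.
move=> baerE N M i f inj_i.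
have [||g gP] := @Baer_extension M
    (fun x y => exists2 n, x = i n & y = f n) baerE.
- split=> [|a _ _ _ _ [n -> ->] [n' -> ->]].
    by exists 0; rewrite linear0.
  by exists (a *: n + n'); rewrite linearP.
- move=> _ [n /esym + ->]; rewrite -(linear0 i) => /inj_i ->.
  by rewrite linear0.
by exists g => x; apply: gP; exists x.
Qed.

Lemma injective_extension (V : lmodType R) (T : V -> E -> Prop) :
  injective_module E -> linear_rel T -> functional_rel T ->
  exists g : {linear V -> E}, forall x y, T x y -> g x = y.
Proof.
move=> injE linT funT.
have domP : is_submodule (fun x => exists y, T x y).
  split=> [|a u v [x Tx] [y Ty]]; first by exists 0; case: linT.
  by exists (a *: x + y); case: linT => _; apply.
pose D := submodule_type (submodule_of domP).
have [|y|x|f fP] := @linear_rel_total R D E (fun x y => T (val x) y).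
- by split=> [|a x y x' y' Txy Txy']; [case: linT|case: linT => _; apply].
- exact: funT.
- by have /in_submodule_of := valP x.
have [g gP] := injE D V (val : {linear D -> V}) f val_inj.
exists g => x y Txy.
have xD : x \in submodule_of domP by apply/in_submodule_of; exists y.
rewrite -[x]/(val (exist _ x xD : D)) gP.
exact: (functional_rel_eq linT funT (fP _)).
Qed.

Lemma injective_Baer : injective_module E -> Baer_injective.
Proof.
move=> injE T linT funT; have [g gP] := injective_extension injE linT funT.
exists (g 1) => r z Trz.
by rewrite -linearZ /= -(gP _ _ Trz) /GRing.scale /= mulr1.
Qed.

End Baer.

(** * The divisible group Q/Z *)

Definition int_in_rat (n : int^o) : zmodule rat := (n : int)%:~R.

Lemma int_in_rat_linear : linear int_in_rat.
Proof.
move=> a x y; rewrite /int_in_rat scalezrE.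
by rewrite [X in X%:~R]/(a * x + y) rmorphD rmorphM mulrzl.
Qed.

HB.instance Definition _ :=
  GRing.isLinear.Build int int^o (zmodule rat) *:%R int_in_rat
    int_in_rat_linear.

Definition rat_mod_int : lmodType int := quotmod (limage int_in_rat).
Definition rat_proj : {linear zmodule rat -> rat_mod_int} :=
  quotmod_proj (limage int_in_rat).

Lemma rat_proj_eq0 (q : rat) :
  rat_proj q = 0 <-> exists n : int, q = n%:~R.
Proof.
rewrite -(linear0 rat_proj); split=> [/quotmod_projP|[n qn]].
  by rewrite subr0 => /asboolP[n <-]; exists n.
by apply/quotmod_projP; rewrite subr0; apply/asboolP; exists n.
Qed.

Lemma rat_proj_scale (n : int) (q : rat) :
  n *: rat_proj q = rat_proj (n%:~R * q).
Proof. by rewrite -linearZ /= scalezrE mulrzl. Qed.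

(** Baer's condition holds because the ideals of Z are principal and Q/Z is
    divisible. *)
Lemma injective_rat_mod_int : injective_module rat_mod_int.
Proof.
apply: Baer_injective_module => T linT funT.
have [[n0 [n0_gt0 [z0 Tn0]]]|no_pos] :=
    pselect (exists n, (0 < n)%N /\ exists z, T (n%:Z : int^o) z); last first.
  exists 0 => n z Tnz; rewrite scaler0; apply: funT.
  suff n0 : n = 0 by rewrite -n0.
  apply: contrapT => nN0; apply: no_pos; exists `|n|%N; split.
    by rewrite absz_gt0; apply/eqP.
  exists (Num.sg n *: z).
  rewrite abszE normrEsg.
  exact: linear_relZ.
pose P n := (0 < n)%N && `[< exists z, T (n%:Z : int^o) z >].
have exP : exists n, P n.
  by exists n0; rewrite /P n0_gt0; apply/asboolP; exists z0.
case: (ex_minnP exP) => n /andP[n_gt0 /asboolP[z Tnz]] minn.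
have [q qz] := quotmod_proj_surj z.
have nN0 : n%:~R != 0 :> rat by rewrite intr_eq0 -lt0n.
exists (rat_proj (q / n%:~R)) => m w Tmw.
have zE : z = n%:Z *: rat_proj (q / n%:~R).
  by rewrite rat_proj_scale mulrC divfK // -qz.
(* the remainder of m modulo n lies in the domain of T, hence vanishes *)
have mE : m = (m %/ n)%Z * n.
  rewrite {1}(divz_eq m n) (_ : (m %% n)%Z = 0) ?addr0 //.
  apply/eqP; apply: contraT => rN0.
  have r_ge0 : 0 <= (m %% n)%Z by rewrite modz_ge0 // -lt0n.
  have Pr : P `|(m %% n)%Z|%N.
    rewrite /P absz_gt0 rN0; apply/asboolP; exists (w - (m %/ n)%Z *: z).
    rewrite gez0_abs //
      (_ : (m %% n)%Z = (m : int^o) - (m %/ n)%Z *: (n%:Z : int^o)).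
      by apply: linear_relB => //; apply: linear_relZ.
    by rewrite {2}(divz_eq m n) addrC addKr.
  have := minn _ Pr; rewrite leqNgt -ltz_nat gez0_abs //.
  by rewrite ltz_pmod.
have := linear_relZ (m %/ n)%Z linT Tnz.
rewrite -[_ *: _]/((m %/ n)%Z * n) -mE => Tmz.
by rewrite (functional_rel_eq linT funT Tmw Tmz) {2}mE zE scalerA.
Qed.

(** Q/Z is a cogenerator: k m = 0 forces n to divide k, where n is the order
    of m, or 2 when that order is infinite; so m may be sent to 1/n. *)
Lemma exists_character (M : zmodType) (m : M) : m != 0 ->
  exists chi : {linear zmodule M -> rat_mod_int}, chi m != 0.
Proof.
move=> mN0.
have [n n_gt1 nP] : exists2 n, (1 < n)%N &
    forall k : int, m *~ k = 0 -> (n%:Z %| k)%Z.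
  have [[n1 [n1_gt0 mn1]]|inf_ord] :=
      pselect (exists n, (0 < n)%N /\ m *+ n = 0).
    have exn : exists n, (0 < n)%N && (m *+ n == 0).
      by exists n1; rewrite n1_gt0; apply/eqP.
    case: (ex_minnP exn) => n /andP[n_gt0 /eqP mn] minn.
    exists n => [|k mk].
      case: n n_gt0 mn {minn} => // -[|//] _; rewrite mulr1n => m0.
      by rewrite m0 eqxx in mN0.
    apply/dvdz_mod0P/eqP; apply: contraT => rN0.
    have r_ge0 : 0 <= (k %% n)%Z by rewrite modz_ge0 // -lt0n.
    have := minn `|(k %% n)%Z|%N.
    rewrite absz_gt0 rN0 -[m *+ _]/(m *~ `|(k %% n)%Z|%N%:Z) gez0_abs //.
    have -> : m *~ (k %% n)%Z = 0.
      move: mk; rewrite {1}(divz_eq k n) mulrzDr mulrC mulrzA.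
      by rewrite -[m *~ n%:Z]/(m *+ n) mn mul0rz add0r.
    rewrite eqxx => /(_ isT); rewrite leqNgt -ltz_nat gez0_abs //.
    by rewrite ltz_pmod.
  exists 2 => // k mk; suff -> : k = 0 by rewrite dvdz0.
  apply: contrapT => /eqP kN0; apply: inf_ord; exists `|k|%N.
  rewrite absz_gt0; split=> //.
  by rewrite -[m *+ _]/(m *~ `|k|%N%:Z) abszE normrEsg mulrC mulrzA mk mul0rz.
pose d := rat_proj (n%:~R^-1).
have nN0 : n%:~R != 0 :> rat by rewrite intr_eq0 -lt0n (ltn_trans _ n_gt1).
have dP k : m *~ k = 0 -> k *: d = 0.
  move=> /nP/dvdzP[q ->]; rewrite rat_proj_scale; apply/rat_proj_eq0.
  by exists q; rewrite rmorphM /= mulfK.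
have [|z [k [mk ->]]|chi chiP] := @injective_extension _ rat_mod_int (zmodule M)
    (fun x z => exists k : int, x = m *~ k /\ z = k *: d) injective_rat_mod_int.
- split=> [|a _ _ _ _ [k [-> ->]] [k' [-> ->]]].
    by exists 0; rewrite mulr0z scale0r.
  exists (a * k + k'); split; last by rewrite scalerDl scalerA.
  by rewrite scalezrE mulrzDr [a * k]mulrC mulrzA.
- exact: dP.
exists chi; rewrite (chiP _ d); last by exists 1; rewrite mulr1z scale1r.
apply/eqP => /rat_proj_eq0[k nk].
have : (1%N%:Z = k * n%:Z).
  by apply: (@intr_inj rat); rewrite rmorphM /= -nk mulVf.
move=> /(congr1 absz); rewrite abszM /= => /esym/eqP.
by rewrite muln_eq1 andbC => /andP[/eqP n1]; rewrite n1 in n_gt1.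
Qed.

(** * Injective hulls *)

Lemma injective_retract (R : pzRingType) (E Q : lmodType R)
    (i : {linear E -> Q}) (p : {linear Q -> E}) :
  injective_module Q -> cancel i p -> injective_module E.
Proof.
move=> injQ ipK N M j f inj_j.
have [g gP] := injQ N M j (i \o f) inj_j.
by exists (p \o g) => x /=; rewrite gP /= ipK.
Qed.

Section Coinduced.
Variables (R : pzRingType) (D : zmodType) (I : Type).

(** The power of Hom_Z(R, D) indexed by I; R acts by right translation of the
    argument. *)
Record coinduced := Coinduced {
  coind_fun :> R -> I -> D;
  coind_funB : forall r s j, coind_fun (r - s) j = coind_fun r j - coind_fun s j
}.

HB.instance Definition _ := gen_eqMixin coinduced.
HB.instance Definition _ := gen_choiceMixin coinduced.

Lemma coindP (u v : coinduced) : (forall r j, u r j = v r j) -> u = v.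
Proof.
case: u v => [u uB] [v vB] /= uv.
have {}uv : u = v by apply/funext => r; apply/funext.
by case: _ / uv in vB *; congr Coinduced; apply: Prop_irrelevance.
Qed.

Lemma coind_fun0 (u : coinduced) j : u 0 j = 0.
Proof. by have := coind_funB u 0 0 j; rewrite !subrr. Qed.

Lemma coind_funD (u : coinduced) r s j : u (r + s) j = u r j + u s j.
Proof.
by rewrite -[s in LHS]opprK -[- s]sub0r !coind_funB coind_fun0 sub0r opprK.
Qed.

Program Definition coind_zero : coinduced := @Coinduced (fun _ _ => 0) _.
Next Obligation. by rewrite subrr. Qed.

Program Definition coind_opp (u : coinduced) : coinduced :=
  @Coinduced (fun r j => - u r j) _.
Next Obligation. by rewrite coind_funB opprB opprK addrC. Qed.

Program Definition coind_add (u v : coinduced) : coinduced :=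
  @Coinduced (fun r j => u r j + v r j) _.
Next Obligation. by rewrite !coind_funB opprD addrACA. Qed.

Program Definition coind_scale (a : R) (u : coinduced) : coinduced :=
  @Coinduced (fun r j => u (r * a) j) _.
Next Obligation. by rewrite mulrBl coind_funB. Qed.

Lemma coind_addA : associative coind_add.
Proof. by move=> u v w; apply: coindP => r j /=; rewrite addrA. Qed.
Lemma coind_addC : commutative coind_add.
Proof. by move=> u v; apply: coindP => r j /=; rewrite addrC. Qed.
Lemma coind_add0 : left_id coind_zero coind_add.
Proof. by move=> u; apply: coindP => r j /=; rewrite add0r. Qed.
Lemma coind_addN : left_inverse coind_zero coind_opp coind_add.
Proof. by move=> u; apply: coindP => r j /=; rewrite addNr. Qed.

HB.instance Definition _ :=
  GRing.isZmodule.Build coinduced coind_addA coind_addC coind_add0 coind_addN.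

Lemma coind_scaleA a b u :
  coind_scale a (coind_scale b u) = coind_scale (a * b) u.
Proof. by apply: coindP => r j /=; rewrite mulrA. Qed.
Lemma coind_scale1 : left_id 1 coind_scale.
Proof. by move=> u; apply: coindP => r j /=; rewrite mulr1. Qed.
Lemma coind_scaleDr : right_distributive coind_scale +%R.
Proof. by move=> a u v; apply: coindP. Qed.
Lemma coind_scaleDl u : {morph coind_scale^~ u : a b / a + b}.
Proof. by move=> a b; apply: coindP => r j /=; rewrite mulrDr coind_funD. Qed.

HB.instance Definition _ := GRing.Zmodule_isLmodule.Build R coinduced
  coind_scaleA coind_scale1 coind_scaleDr coind_scaleDl.

End Coinduced.

(** Evaluation at 1 turns linear maps into the coinduced module into I-indexed
    families of additive maps into D, and each of those can be extended. *)
Lemma injective_coinduced (R : pzRingType) (D : lmodType int) (I : Type) :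
  injective_module D -> injective_module (coinduced R D I).
Proof.
move=> injD N M i f inj_i.
have /choice[G GP] : forall j : I, exists g : {linear zmodule M -> D},
    forall n, g (i n) = f n 1 j.
  move=> j.
  have [|z [n [/esym i0 ->]]|g gP] := @injective_extension _ D (zmodule M)
      (fun x z => exists n, x = i n /\ z = f n 1 j) injD.
  - split=> [|a _ _ _ _ [n [-> ->]] [n' [-> ->]]].
      by exists 0; rewrite !linear0.
    exists (n *~ a + n'); rewrite !raddfD !raddfMz; split=> //=.
    congr (_ + _); elim/int_rect: a => [|a IHa|a IHa].
    + by rewrite scale0r.
    + by rewrite intS scalerDl scale1r IHa mulrzDr.
    + by rewrite intS opprD scalerDl scaleN1r IHa mulrzDr.
  - by rewrite -(linear0 i) in i0; rewrite (inj_i _ _ i0) linear0.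
  by exists g => n; apply: gP; exists n.
have GB (x : M) (r s : R) j : G j ((r - s) *: x) = G j (r *: x) - G j (s *: x).
  by rewrite scalerBl raddfB.
pose h x : coinduced R D I := Coinduced (GB x).
have [a x y|g gh] := @linear_exists _ _ _ h.
  by apply: coindP => r j /=; rewrite scalerDr scalerA raddfD.
exists g => n; rewrite gh; apply: coindP => r j /=.
by rewrite -linearZ GP linearZ /= mul1r.
Qed.

(** One copy of Hom_Z(R, Q/Z) for each m in M is enough: it is used for a
    character which does not vanish at m. *)
Lemma enough_injectives (R : pzRingType) (M : lmodType R) :
  exists (Q : lmodType R) (j : {linear M -> Q}),
    injective_module Q /\ injective j.
Proof.
pose Q : lmodType R := coinduced R rat_mod_int M.
have /choice[chi chiP] : forall m : M, exists chi :
    {linear zmodule M -> rat_mod_int}, m != 0 -> chi m != 0.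
  move=> m; have [_|/exists_character[chi chim]] := eqVneq m 0.
    by exists \0.
  by exists chi.
have chiB (x : M) (r s : R) m :
    chi m ((r - s) *: x) = chi m (r *: x) - chi m (s *: x).
  by rewrite scalerBl raddfB.
pose h x : Q := Coinduced (chiB x).
have [a x y|j jh] := @linear_exists _ _ _ h.
  by apply: coindP => r m /=; rewrite scalerDr scalerA raddfD.
exists Q, j; split; first exact/injective_coinduced/injective_rat_mod_int.
apply: raddf_inj => m jm; apply: contrapT => /eqP /chiP/eqP; apply.
have : j m 1 m = 0 by rewrite jm.
by rewrite jh /= scale1r.
Qed.

Section InjectiveHull.
Variables (R : pzRingType) (Q : lmodType R).

Definition essential_over (S S' : set Q) := forall x, S' x -> x != 0 ->
  exists r : R, r *: x != 0 /\ S (r *: x).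

(** A submodule E of an injective Q which is maximal among the essential
    extensions of S is a retract of Q: with K maximal such that K meets E
    in 0, the projection of E + K onto E extends to h : Q -> Q, whose kernel is
    K by maximality of K, so that h Q is essential over E, hence equal to E. *)
Lemma maximal_essential_retract (S E : set Q) :
  injective_module Q -> is_submodule E -> essential_over S E ->
  (forall E', subset E E' -> is_submodule E' -> essential_over S E' ->
     E' = E) ->
  exists h : {linear Q -> Q}, (forall x, E (h x)) /\ (forall x, E x -> h x = x).
Proof.
move=> injQ subE essE maxE.
pose P (K : set Q) := is_submodule K /\ forall x, K x -> E x -> x = 0.
have [|C CP totC [X0 CX0]|K [[subK KE] _ maxK]] :=
    @Zorn_above _ P (fun x => x = 0).
- by split=> //; split=> // a u v -> ->; rewrite scaler0 add0r.
- split; last by move=> x [X /CP[_ XE] /XE].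
  by apply: bigcup_submodule => //; [move=> X /CP[]|exists X0].
have [E0 EP] := subE; have [K0 KP] := subK.
have [|y [Ey]|h hP] :=
    @injective_extension _ Q Q (fun x y => E y /\ K (x - y)) injQ.
- split=> [|a x y x' y' [Ey Ky] [Ey' Ky']]; first by rewrite subrr.
  by split; [exact: EP|rewrite opprD addrACA -scalerBr; exact: KP].
- rewrite sub0r => Ky; apply: KE => //.
  by have := KP (-1) _ _ Ky K0; rewrite scaleN1r opprK addr0.
have hE x : E x -> h x = x by move=> Ex; apply: hP; rewrite subrr.
have hK x : K x -> h x = 0 by move=> Kx; apply: hP; rewrite subr0.
exists h; split=> // x.
suff <- : range h = E by exists x.
apply: maxE => [y Ey||].
- by exists y; rewrite // hE.
- split=> [|a _ _ [u _ <-] [v _ <-]]; first by exists 0; rewrite ?linear0.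
  by exists (a *: u + v); rewrite ?linearP.
move=> _ [q _ <-] hqN0.
pose K' : set Q := fun x => exists k r, K k /\ x = k + r *: q.
have [[k [r [Kk Ekr krN0]]]|trivK'] := pselect
    (exists k r, [/\ K k, E (k + r *: q) & k + r *: q != 0]).
  have eE : r *: h q = k + r *: q.
    by rewrite -(hE _ Ekr) linearD (hK k) // add0r linearZ.
  have [s [sN0 Ss]] := essE _ Ekr krN0.
  by exists (s * r); rewrite -scalerA eE.
have K'K : K' = K.
  apply: maxK => [k Kk|]; first by exists k, 0; rewrite scale0r addr0.
  split; first split.
  - by exists 0, 0; rewrite scale0r addr0.
  - move=> a _ _ [k [r [Kk ->]]] [k' [r' [Kk' ->]]].
    exists (a *: k + k'), (a * r + r'); split; first exact: KP.
    by rewrite scalerDr scalerDl scalerA addrACA.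
  - move=> _ [k [r [Kk ->]]] Ekr; apply: contrapT => /eqP krN0.
    by apply: trivK'; exists k, r.
have Kq : K q by rewrite -K'K; exists 0, 1; rewrite scale1r add0r.
by rewrite hK ?eqxx in hqN0.
Qed.

End InjectiveHull.

(** The hull is a maximal essential extension of M inside an injective module;
    being a retract of that module, it is injective. *)
Lemma exists_injective_hull (R : pzRingType) (M : lmodType R) :
  exists (E : lmodType R) (i : {linear M -> E}), injective_hull i.
Proof.
have [Q [j [injQ inj_j]]] := enough_injectives M.
pose P (E : set Q) := is_submodule E /\ essential_over (range j) E.
have [|C CP totC [X0 CX0]|E [[subE essE] sjE maxE]] :=
    @Zorn_above _ P (range j).
- split; last by move=> x jx xN0; exists 1; rewrite scale1r.
  split=> [|a _ _ [u _ <-] [v _ <-]]; first by exists 0; rewrite ?linear0.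
  by exists (a *: u + v); rewrite ?linearP.
- split; last by move=> x [X /CP[_ essX] /essX].
  by apply: bigcup_submodule => //; [move=> X /CP[]|exists X0].
have [E' sEE' subE' essE'|h [hE hid]] :=
    maximal_essential_retract injQ subE essE.
  exact: maxE.
pose H : lmodType R := submodule_type (submodule_of subE).
pose incl : {linear H -> Q} := val.
have incl_onto x : E x -> exists y, incl y = x.
  move=> Ex; have xE : x \in submodule_of subE by apply/in_submodule_of.
  by exists (exist _ x xE).
have [x|i ij] := linear_lift (i := incl) (h := j) val_inj.
  by apply: incl_onto; apply: sjE; exists x.
have [x|p ph] := linear_lift (i := incl) (h := h) val_inj.
  exact: incl_onto.
exists H, i; split.
- by move=> x y /(congr1 incl); rewrite !ij => /inj_j.
- apply: (injective_retract (i := incl) (p := p) injQ) => x.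
  apply: val_inj; rewrite -[LHS]/(incl (p (incl x))) ph hid //.
  by apply/in_submodule_of/(valP x).
- move=> L Lj x Lx; apply: contrapT => /eqP xN0.
  have xE : E (incl x) by apply/in_submodule_of/(valP x).
  have [|r [rxN0 [m _ jm]]] := essE _ xE.
    by rewrite -(linear0 incl) (inj_eq val_inj).
  have imE : i m = r *: x.
    by apply: val_inj; rewrite -[LHS]/(incl (i m)) ij jm linearZ.
  have /Lj : r *: x \in limage i by apply/asboolP; exists m.
  rewrite rpredZ // => /(_ isT) rx0.
  by move: rxN0; rewrite -linearZ rx0 linear0 eqxx.
Qed.

(** * Ideals of commutative Noetherian rings *)

Lemma scale_commute (R : comPzRingType) (V : lmodType R) (a b : R) (x : V) :
  a *: (b *: x) = b *: (a *: x).
Proof. by rewrite !scalerA mulrC. Qed.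

Section Ideals.
Variable R : comPzRingType.

Section IdealClosure.
Variable I : ideal R.

Lemma ideal0 : (0 : R) \in I.
Proof. by apply: (rpred0 I). Qed.

Lemma idealD (a b : R) : a \in I -> b \in I -> a + b \in I.
Proof. by move=> Ia Ib; apply: (@rpredD _ I). Qed.

Lemma idealM (c a : R) : a \in I -> c * a \in I.
Proof. exact: (@GRing.rpredZ _ _ I). Qed.

Lemma idealB (a b : R) : a \in I -> b \in I -> a - b \in I.
Proof. by move=> Ia Ib; rewrite -mulN1r idealD ?idealM. Qed.

Lemma ideal_full : 1 \in I -> forall x, x \in I.
Proof. by move=> I1 x; rewrite -[x]mulr1 idealM. Qed.

End IdealClosure.

Definition ideal_of (S : R^o -> Prop) (subS : is_submodule S) : ideal R :=
  submodule_of subS.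

Lemma in_ideal_of (S : R^o -> Prop) (subS : is_submodule S) r :
  r \in ideal_of subS <-> S r.
Proof. exact: in_submodule_of. Qed.

Lemma noetherian_maximal (F : ideal R -> Prop) :
  noetherian R -> (exists I, F I) ->
  exists I, F I /\ forall J, F J -> {subset I <= J} -> {subset J <= I}.
Proof.
move=> noethR [I0 FI0]; apply: contrapT => noMax.
have /choice[next nextP] : forall I : {I : ideal R | F I},
    exists J : {J : ideal R | F J},
    {subset sval I <= sval J} /\ ~ {subset sval J <= sval I}.
  case=> I FI; apply: contrapT => noJ; apply: noMax; exists I.
  split=> // J FJ sIJ.
  by apply: contrapT => nsJI; apply: noJ; exists (exist _ J FJ).
pose I n := sval (iter n next (exist _ I0 FI0)).
have [n|n nP] := noethR I.
  by case: (nextP (iter n next (exist _ I0 FI0))).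
have [_] := nextP (iter n next (exist _ I0 FI0)).
by apply=> x; rewrite -[sval (next _)]/(I n.+1) nP.
Qed.

Definition prime_ideal (P : ideal R) : Prop :=
  1 \notin P /\ forall a b : R, a * b \in P -> a \in P \/ b \in P.

Lemma exists_maximal_ideal (I : ideal R) : noetherian R -> 1 \notin I ->
  exists m : ideal R, maximal_ideal m /\ {subset I <= m}.
Proof.
move=> noethR I1.
have [|m [[mN1 sIm] maxm]] := @noetherian_maximal
    (fun J => 1 \notin J /\ {subset I <= J}) noethR; first by exists I; split.
exists m; split=> //; split=> [m1|J smJ]; first exact: (negP mN1).
have [J1|JN1] := boolP (1 \in J); [right; exact: ideal_full|left=> x].
apply/idP/idP=> [|/smJ //]; apply: maxm => //; split=> // y /sIm; exact: smJ.
Qed.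

Lemma maximal_ideal_N1 (m : ideal R) : maximal_ideal m -> 1 \notin m.
Proof. by case=> mN _; apply/negP => m1; apply: mN; apply: ideal_full. Qed.

Lemma maximal_ideal_inverse (m : ideal R) (a : R) :
  maximal_ideal m -> a \notin m -> exists b, 1 - b * a \in m.
Proof.
move=> [mN maxm] aNm.
pose S (x : R^o) := exists b : R, x - b * a \in m.
have subS : is_submodule S.
  split=> [|c u v [b ub] [d vd]]; first by exists 0; rewrite mul0r subr0 ideal0.
  exists (c * b + d); rewrite mulrDl opprD addrACA -mulrA -mulrBr.
  by rewrite idealD ?idealM.
case: (maxm (submodule_of subS)) => [x xm|Sm|/(_ 1)/in_submodule_of//].
  by apply/in_submodule_of; exists 0; rewrite mul0r subr0.
have : a \in submodule_of subS.
  by apply/(in_submodule_of subS); exists 1; rewrite mul1r subrr ideal0.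
by rewrite Sm (negbTE aNm).
Qed.

Lemma annihilator_submodule (M : lmodType R) (y : M) :
  is_submodule (fun a : R^o => (a : R) *: y = 0).
Proof.
split=> [|a u v uy vy]; first by rewrite scale0r.
by rewrite scalerDl vy addr0 -scalerA uy scaler0.
Qed.

Definition annihilator (M : lmodType R) (y : M) : ideal R :=
  submodule_of (annihilator_submodule y).

Lemma in_annihilator (M : lmodType R) (y : M) (a : R) :
  (a \in annihilator y) = (a *: y == 0).
Proof. by apply/idP/eqP => /(in_submodule_of (annihilator_submodule y)). Qed.

(** An annihilator which is maximal among those of the nonzero multiples of y is
    prime. *)
Lemma associated_prime (M : lmodType R) (y : M) : noetherian R -> y != 0 ->
  exists r : R, r *: y != 0 /\ prime_ideal (annihilator (r *: y)).
Proof.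
move=> noethR yN0.
have [|_ [[r [ryN0 ->]] maxr]] := @noetherian_maximal
    (fun J => exists r : R, r *: y != 0 /\ J = annihilator (r *: y)) noethR.
  by exists (annihilator (1 *: y)), 1; rewrite scale1r.
exists r; split=> //; split=> [|a b]; first by rewrite in_annihilator scale1r.
rewrite !in_annihilator => /eqP aby.
have [by0|byN0] := eqVneq (b *: (r *: y)) 0; [by right; apply/eqP|left].
suff : a \in annihilator (r *: y) by rewrite in_annihilator.
apply: (maxr (annihilator ((b * r) *: y))).
- by exists (b * r); rewrite -scalerA.
- move=> c; rewrite !in_annihilator => /eqP cry.
  by rewrite -scalerA scalerA mulrC -scalerA cry scaler0.
- by rewrite in_annihilator -scalerA scalerA aby.
Qed.

End Ideals.

(** * A criterion for injective modules to be projective *)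

(** Every nonzero submodule contains y: R y is simple, and E is an essential
    extension of R y. *)
Definition socle_generator (R : pzRingType) (E : lmodType R) (y : E) :=
  y != 0 /\ forall x, x != 0 -> exists a : R, a *: x = y.

Section RelativelyInjective.
Variables (R : pzRingType) (M : lmodType R).

(** Injectivity of a submodule, expressed through partial maps of R so that no
    module structure on S itself is involved. *)
Definition Baer_submodule (S : set M) :=
  forall T : R^o -> M -> Prop, linear_rel T -> functional_rel T ->
  (forall r z, T r z -> S z) ->
  exists2 y, S y & forall (r : R) z, T r z -> z = r *: y.

Lemma Baer_submodule_retract (S : set M) :
  is_submodule S -> Baer_submodule S ->
  exists p : {linear M -> M}, (forall x, S (p x)) /\ (forall x, S x -> p x = x).
Proof.
move=> subS baerS.
pose H : lmodType R := submodule_type (submodule_of subS).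
have HP (x : H) : S (val x) by apply/in_submodule_of/(valP x).
have baerH : Baer_injective H.
  move=> T [T0 TP] funT.
  have [||_ z [u _ <-]|y Sy yP] :=
      baerS (fun r z => exists2 u, T r u & val u = z).
  - split=> [|a r _ r' _ [u Tu <-] [u' Tu' <-]].
      by exists 0; rewrite ?linear0.
    by exists (a *: u + u'); [exact: TP|rewrite linearP].
  - by move=> _ [u /funT -> <-].
  - exact: HP.
  have yS : y \in submodule_of subS by apply/in_submodule_of.
  exists (exist _ y yS) => r z Trz; apply: val_inj; rewrite linearZ /=.
  by apply: yP; exists z.
have [||p pP] := @Baer_extension _ _ M (fun x (y : H) => x = val y) baerH.
- split=> [|a _ y _ y' -> ->]; first by rewrite linear0.
  by rewrite linearP.
- by move=> y /esym y0; apply: val_inj.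
pose incl : {linear H -> M} := val.
exists (incl \o p); split=> x; first exact: HP.
move=> Sx; have xS : x \in submodule_of subS by apply/in_submodule_of.
by rewrite /= (pP x (exist _ x xS)).
Qed.

End RelativelyInjective.

(** This is where injectivity of a union uses the chain condition: a map from an
    ideal into the union already takes its values in one member. *)
Lemma Baer_submodule_chain (R : comPzRingType) (M : lmodType R)
    (C : set (set M)) :
  noetherian R -> (forall S, C S -> is_submodule S /\ Baer_submodule S) ->
  total_on C subset -> (exists S, C S) ->
  Baer_submodule (\bigcup_(S in C) S)%classic.
Proof.
move=> noethR CP totC [S0 CS0] T linT funT TC.
have subI S : C S -> is_submodule (fun r : R^o => exists2 z, T r z & S z).
  move=> /CP[[S00 SP] _]; case: linT => T0 TP.
  split=> [|a u v [z Tz Sz] [w Tw Sw]]; first by exists 0.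
  by exists (a *: z + w); [exact: TP|exact: SP].
(* the part of the domain of T which is sent into a member of the chain
   stabilizes, so that T takes its values in a single member *)
have [|I [[S [CS IS]] maxI]] := @noetherian_maximal R
    (fun I => exists S,
       C S /\ forall r, r \in I <-> exists2 z, T r z & S z) noethR.
  exists (ideal_of (subI _ CS0)), S0; split=> // r; exact: in_ideal_of.
have TS r z : T r z -> S z.
  move=> Trz; have [S' CS' S'z] := TC _ _ Trz.
  have [sSS'|] := totC _ _ CS CS'; last exact.
  have rI : r \in I.
    apply: (maxI (ideal_of (subI _ CS'))).
    - by exists S'; split=> // t; apply: in_ideal_of.
    - by move=> t /IS[w Tw /sSS' S'w]; apply/in_ideal_of; exists w.
    - by apply/in_ideal_of; exists z.
  have /IS[w Trw Sw] := rI.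
  by rewrite (functional_rel_eq linT funT Trz Trw).
have [_ baerS] := CP _ CS.
by have [y Sy yP] := baerS T linT funT TS; exists y => //; exists S.
Qed.

Section Criterion.
Variable A : comPzRingType.
Hypothesis noethA : noetherian A.
Hypothesis primeA : forall P : ideal A, prime_ideal P ->
  exists (E : lmodType A) (y : E),
    [/\ injective_module E, projective_module E, socle_generator y
      & annihilator y =i P].

(** For an associated prime of Q, the annihilator of some y in Q, the module E
    which the hypothesis provides has a generator y' of its socle with the same
    annihilator. The partial map y' |-> y extends to E; it is injective because
    E is essential over A y', and p brings its values back into Q. *)
Lemma injective_contains_projective (M : lmodType A) (Q : submodClosed M)
    (p : {linear M -> M}) :
  injective_module M -> (forall x, p x \in Q) ->
  (exists2 x, x \in Q & x != 0) ->
  (forall x, x \in Q -> p x = x) ->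
  exists (E : lmodType A) (k : {linear E -> M}),
    [/\ injective_module E, projective_module E, injective k,
      (forall w, k w \in Q) & exists w, k w != 0].
Proof.
move=> injM pQ [y0 Qy0 y0N0] pid.
have [r [yN0 /primeA[E [y' [injE projE [y'N0 y'P] annP]]]]] :=
  associated_prime noethA y0N0.
set y := r *: y0 in yN0 annP.
have Qy : y \in Q by apply: rpredZ.
have [|z [a [/esym + ->]]|g gP] := @injective_extension _ M E
    (fun x z => exists a : A, x = a *: y' /\ z = a *: y) injM.
- split=> [|a _ _ _ _ [b [-> ->]] [c [-> ->]]].
    by exists 0; rewrite !scale0r.
  by exists (a * b + c); rewrite !scalerDl !scalerA.
- by move=> /eqP; rewrite -in_annihilator annP in_annihilator => /eqP.
have gy' : g y' = y by apply: gP; exists 1; rewrite !scale1r.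
have pgy : p (g y') = y by rewrite gy' pid.
exists E, (p \o g); split=> //.
- apply: raddf_inj => x px0; apply: contrapT => /eqP /y'P[a ax].
  have pgx : p (g x) = 0 := px0.
  by move: yN0; rewrite -pgy -ax linearZ /= linearZ /= pgx scaler0 eqxx.
- by move=> w; apply: pQ.
- by exists y'; rewrite /= pgy.
Qed.

(** To lift f along p, consider the liftings G defined on an injective submodule
    of M. If a maximal G is not total, its domain has a nonzero complement,
    which contains an injective projective module E; f also lifts on E, and G
    extends to the direct sum of its domain and E, still an injective module. *)
Theorem QF_criterion : quasi_Frobenius A.
Proof.
move=> M injM U N p f p_onto.
pose dom (G : set (M * U)) : set M := fun x => exists u, G (x, u).
pose P (G : set (M * U)) :=
  [/\ linear_rel (fun x u => G (x, u)), functional_rel (fun x u => G (x, u)),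
      (forall x u, G (x, u) -> p u = f x) & Baer_submodule (dom G)].
have subdom (G : set (M * U)) :
    linear_rel (fun x u => G (x, u)) -> is_submodule (dom G).
  move=> [G0 GP]; split=> [|a x y [u Gu] [v Gv]]; first by exists 0.
  by exists (a *: u + v); apply: GP.
have [|C CP totC [X0 CX0]|G [[linG funG Gp baerG] _ maxG]] :=
    @Zorn_above _ P (fun w => w = (0, 0)).
- split.
  + by split=> // a x y x' y' [-> ->] [-> ->]; rewrite !scaler0 !addr0.
  + by move=> u [].
  + by move=> x u [-> ->]; rewrite !linear0.
  + move=> T linT funT T0; exists 0; first by exists 0.
    by move=> r z /T0[u [-> _]]; rewrite scaler0.
- split.
  + apply/linear_rel_graph/bigcup_submodule => //; last by exists X0.
    by move=> X /CP[/linear_rel_graph].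
  + by move=> y [X /CP[_ funX _ _] /funX].
  + by move=> x u [X /CP[_ _ Xp _] /Xp].
  + rewrite (_ : dom _ = (\bigcup_(S in [set dom X | X in C]) S)%classic).
      apply: Baer_submodule_chain => //.
      * by move=> _ [X /CP[linX _ _ baerX] <-]; split=> //; apply: subdom.
      * move=> _ _ [X CX <-] [Y CY <-].
        by case: (totC _ _ CX CY) => s; [left|right] => x [u Xu];
          exists u; apply: s.
      * by exists (dom X0), X0.
    apply/predeqP => x; split=> [[u [X CX Xxu]]|[_ [X CX <-] [u Xxu]]].
      by exists (dom X); [exists X|exists u].
    by exists u, X.
suff totG x : exists u, G (x, u).
  have [g gG] := linear_rel_total linG funG totG.
  by exists g => x; apply: Gp.
have [q [qG qid]] := Baer_submodule_retract (subdom _ linG) baerG.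
apply: contrapT => noGx.
have subK : is_submodule (fun x => q x = 0).
  split=> [|a u v qu qv]; first by rewrite linear0.
  by rewrite linearP qu qv scaler0 addr0.
have [h hE] : exists h : {linear M -> M}, forall w, h w = w - q w.
  by exists (idfun \- q).
have [||w Kw|E [k [injE projE inj_k kK [w0 kw0]]]] :=
    @injective_contains_projective M (submodule_of subK) h injM.
- by move=> w; apply/in_submodule_of; rewrite hE linearB /= [q (q w)]qid ?subrr.
- exists (h x).
    by apply/in_submodule_of; rewrite hE linearB /= [q (q x)]qid ?subrr.
  rewrite hE subr_eq0; apply/eqP => xq; apply: noGx; rewrite xq; exact: qG.
- by have /in_submodule_of qw := Kw; rewrite hE qw subr0.
have {}kK w : q (k w) = 0 by have /in_submodule_of := kK w.
have [l lP] := projE U N p (f \o k) p_onto.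
pose G' : set (M * U) :=
  fun w => exists x u v, G (x, u) /\ w = (x + k v, u + l v).
have G'G : G' = G.
  apply: maxG => [[y u] Gyu|].
    by exists y, u, 0; rewrite !linear0 !addr0.
  have [G0 GP] := linG.
  split.
  + split; first by exists 0, 0, 0; rewrite !linear0 !addr0.
    move=> a _ _ _ _ [y [u [v [Gyu [-> ->]]]]] [y' [u' [v' [Gyu' [-> ->]]]]].
    exists (a *: y + y'), (a *: u + u'), (a *: v + v'); split; first exact: GP.
    by congr pair; rewrite linearP scalerDr addrACA.
  + move=> _ [y [u [v [Gyu [/esym ykv ->]]]]].
    have y0 : y = 0.
      have := congr1 q ykv; rewrite linear0 linearD kK addr0 qid //.
      by exists u.
    rewrite y0 in ykv Gyu; rewrite add0r -(linear0 k) in ykv.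
    by rewrite (inj_k _ _ ykv) linear0 addr0; apply: funG.
  + move=> _ _ [y [u [v [Gyu [-> ->]]]]].
    by rewrite !linearD /= (Gp _ _ Gyu) lP.
  + move=> T linT funT TG.
    have G'q y : dom G' y -> exists v, y = q y + k v.
      move=> [_ [z [u [v [Gzu [-> _]]]]]]; exists v.
      by rewrite linearD /= kK addr0 qid //; exists u.
    have [||r _ [z _ ->]|y1 Gy1 y1P] :=
        baerG (fun r y => exists2 z, T r z & y = q z).
    * split=> [|a r _ r' _ [z Tz ->] [z' Tz' ->]].
        by exists 0; rewrite ?linear0; case: linT.
      by exists (a *: z + z'); rewrite ?linearP //; case: linT => _; apply.
    * by move=> _ [z /funT -> ->]; rewrite linear0.
    * exact: qG.
    have [||y2 y2P] := injective_Baer injE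
        (T := fun r v => exists2 z, T r z & z = q z + k v).
    * split=> [|a r v r' v' [z Tz zE] [z' Tz' z'E]].
        by exists 0; rewrite ?linear0 ?addr0 //; case: linT.
      exists (a *: z + z'); first by case: linT => _; apply.
      by rewrite {1}zE {1}z'E !linearP scalerDr addrACA.
    * move=> v [z /funT ->]; rewrite linear0 add0r => /esym.
      by rewrite -(linear0 k) => /inj_k.
    exists (y1 + k y2).
      by have [u Gu] := Gy1; exists (u + l y2), y1, u, y2.
    move=> r z Trz; have [v zE] := G'q _ (TG _ _ Trz).
    rewrite zE scalerDr -linearZ -(y1P r (q z)); last by exists z.
    by rewrite -(y2P r v) //; exists z.
have Gk : dom G (k w0).
  exists (l w0); rewrite -G'G; exists 0, 0, w0; rewrite !add0r.
  by case: linG.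
by move: kw0; rewrite -(qid _ Gk) kK eqxx.
Qed.

End Criterion.

(** * A criterion for a ring to be small *)

(** With N the sum of the a E for a in l, this says that x lies in that sum as
    soon as the common annihilator of l kills x. By induction on the sequence
    a :: l: if K is the annihilator of l, then r a |-> r x is well defined on
    K a, so some y satisfies r x = r a y for r in K, and x - a y is killed by
    K. *)
Lemma injective_sum_multiples (R : comPzRingType) (E : lmodType R)
    (N : E -> Prop) (l : seq R) (x : E) :
  injective_module E -> is_submodule N ->
  (forall a y, a \in l -> N (a *: y)) ->
  (forall r, (forall a, a \in l -> r * a = 0) -> r *: x = 0) ->
  N x.
Proof.
move=> injE [N0 NP]; elim: l x => [|a l IHl] x Nl xP.
  by rewrite -[x]scale1r xP.
pose K r := forall b, b \in l -> r * b = 0.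
pose T (u : R^o) z := exists r, [/\ K r, u = r * a & z = r *: x].
have [||y yP] := injective_Baer injE (T := T).
- split=> [|c _ _ _ _ [r [Kr -> ->]] [s [Ks -> ->]]].
    by exists 0; rewrite scale0r mul0r; split=> // b _; rewrite mul0r.
  exists (c * r + s); split.
  + by move=> b lb; rewrite mulrDl -mulrA Kr // mulr0 add0r Ks.
  + by rewrite mulrDl -mulrA.
  + by rewrite scalerDl scalerA.
- move=> _ [r [Kr /esym ra0 ->]]; apply: xP => b.
  by rewrite inE => /orP[/eqP->|/Kr].
have Nay : N (a *: y) by apply: Nl; rewrite mem_head.
have Nx' : N (x - a *: y).
  apply: IHl => [b z lb|r Kr]; first by apply: Nl; rewrite inE lb orbT.
  rewrite scalerBr scalerA -(yP (r * a) (r *: x)) ?subrr //; first by exists r.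
by have := NP 1 _ _ Nx' Nay; rewrite scale1r subrK.
Qed.

(** Some finite part l of m has the same annihilator as m. The chain condition
    is applied to the double annihilators of finite parts of m, which grow with
    l just as the ideals they generate do. *)
Lemma annihilator_finite (R : comPzRingType) (m : ideal R) : noetherian R ->
  exists l : seq R, (forall a, a \in l -> a \in m) /\
    forall r : R, (forall a, a \in l -> r * a = 0) ->
    forall a : R, a \in m -> r * a = 0.
Proof.
move=> noethR.
have subJ (l : seq R) : is_submodule
    (fun a : R^o =>
       forall r, (forall b, b \in l -> r * b = 0) -> r * (a : R) = 0).
  split=> [r _|c u v uP vP r rl]; first by rewrite mulr0.
  by rewrite mulrDr mulrCA uP // mulr0 add0r vP.
have [|_ [[l [lm ->]] maxl]] := @noetherian_maximal R
    (fun J => exists l,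
       (forall a, a \in l -> a \in m) /\ J = ideal_of (subJ l)) noethR.
  by exists (ideal_of (subJ [::])), [::].
exists l; split=> // r rl a am.
suff /in_ideal_of : a \in ideal_of (subJ l) by apply.
apply: (maxl (ideal_of (subJ (a :: l)))).
- exists (a :: l); split=> // b; rewrite inE => /orP[/eqP -> //|]; exact: lm.
- move=> b /in_ideal_of bP; apply/in_ideal_of => s sP; apply: bP => c lc.
  by apply: sP; rewrite inE lc orbT.
- by apply/in_ideal_of => s; apply; rewrite mem_head.
Qed.

(** If no maximal ideal m has a nonzero annihilator, then m E = E for every
    injective E, so E has no simple quotient. If R + L were the whole hull E for
    some proper L, then E/L would be cyclic and nonzero, so it would have one. *)
Theorem small_criterion (R : comPzRingType) : noetherian R ->
  (forall m : ideal R, maximal_ideal m ->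
     forall s : R, (forall a : R, a \in m -> s * a = 0) -> s = 0) ->
  small_ring R.
Proof.
move=> noethR no_socle.
have [E [i hullE]] := exists_injective_hull R^o.
exists E, i; split=> //; have [_ injE _] := hullE.
have iE (r : R) : i r = r *: i 1 by rewrite -linearZ /GRing.scale /= mulr1.
move=> L Lproper LE.
have subJ : is_submodule (fun r : R^o => (r : R) *: i 1 \in L).
  split=> [|a u v Lu Lv]; first by rewrite scale0r rpred0.
  by rewrite scalerDl -scalerA rpredD // rpredZ.
have J1 : 1 \notin ideal_of subJ.
  apply/negP => /in_ideal_of; rewrite scale1r => Li1; apply: Lproper => x.
  have [_ [z [/asboolP[r <-] Lz ->]]] := LE x.
  by rewrite iE rpredD // rpredZ.
have [m [maxm sJm]] := exists_maximal_ideal noethR J1.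
have [l [lm lP]] := annihilator_finite m noethR.
pose N x := exists r z, [/\ r \in m, z \in L & x = r *: i 1 + z].
have subN : is_submodule N.
  split=> [|a _ _ [r [z [mr Lz ->]]] [s [w [ms Lw ->]]]].
    by exists 0, 0; rewrite ideal0 rpred0 scale0r addr0.
  exists (a * r + s), (a *: z + w); split.
  - by rewrite idealD ?idealM.
  - by rewrite rpredD // rpredZ.
  - by rewrite scalerDr scalerDl scalerA addrACA.
have [r [z [mr Lz i1E]]] : N (i 1).
  apply: (injective_sum_multiples (l := l) injE subN) => [a y /lm ma|r rl].
    have [_ [z [/asboolP[r <-] Lz ->]]] := LE y.
    exists (a * r), (a *: z); split; last by rewrite (iE r) scalerDr scalerA.
      by rewrite mulrC idealM.
    exact: rpredZ.
  by rewrite (no_socle m maxm r) ?scale0r //; apply: lP.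
have /sJm m1r : 1 - r \in ideal_of subJ.
  by apply/in_ideal_of; rewrite scalerBl scale1r {1}i1E addrC addKr.
by have := maximal_ideal_N1 maxm; rewrite -(subrK r 1) idealD.
Qed.

(** * Modules over a direct factor of a ring *)

(** The morphism pi identifies A with the direct factor e R of R. *)
Definition ring_factor (R A : comPzRingType) (pi : {rmorphism R -> A}) (e : R) :=
  [/\ forall a, exists r, pi r = a, pi e = 1 & forall r, pi r = 0 -> e * r = 0].

Section Restriction.
Variables (R A : comPzRingType) (pi : {rmorphism R -> A}) (M : lmodType A).

Definition restriction & {rmorphism R -> A} : Type := M.
HB.instance Definition _ := GRing.Zmodule.on (restriction pi).

Definition restriction_scale (r : R) (x : restriction pi) : restriction pi :=
  pi r *: (x : M).

Lemma restriction_scaleA a b x :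
  restriction_scale a (restriction_scale b x) = restriction_scale (a * b) x.
Proof. by rewrite /restriction_scale scalerA rmorphM. Qed.
Lemma restriction_scale1 : left_id 1 restriction_scale.
Proof. by move=> x; rewrite /restriction_scale rmorph1 scale1r. Qed.
Lemma restriction_scaleDr : right_distributive restriction_scale +%R.
Proof. by move=> a x y; rewrite /restriction_scale scalerDr. Qed.
Lemma restriction_scaleDl x : {morph restriction_scale^~ x : a b / a + b}.
Proof. by move=> a b; rewrite /restriction_scale rmorphD scalerDl. Qed.

HB.instance Definition _ := GRing.Zmodule_isLmodule.Build R (restriction pi)
  restriction_scaleA restriction_scale1 restriction_scaleDr restriction_scaleDl.

Lemma restriction_scaleE (r : R) (x : restriction pi) :
  r *: x = pi r *: (x : M).
Proof. by []. Qed.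

End Restriction.
Arguments restriction {R A} M pi.

Section Factor.
Variables (R A : comPzRingType) (pi : {rmorphism R -> A}) (e : R).
Hypothesis factor : ring_factor pi e.

Lemma factor_actE (V : lmodType R) (r s : R) (x : V) :
  e *: x = x -> pi r = pi s -> r *: x = s *: x.
Proof.
case: factor => _ _ ker_pi ex rs; apply/eqP; rewrite -subr_eq0 -scalerBl.
by rewrite -ex scalerA mulrC ker_pi ?scale0r // rmorphB rs subrr.
Qed.

Lemma factor_idem : e * e = e.
Proof.
case: factor => _ pi_e ker_pi; apply/eqP; rewrite -subr_eq0 -{3}[e]mulr1 -mulrBr.
by apply/eqP/ker_pi; rewrite rmorphB pi_e rmorph1 subrr.
Qed.

Definition factor_lift (a : A) : R :=
  let: And3 onto_pi _ _ := factor in sval (cid (onto_pi a)).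

Lemma factor_liftK : cancel factor_lift pi.
Proof.
by rewrite /factor_lift => a; case: factor => onto_pi _ _; case: cid.
Qed.

Section Cut.
Variable V : lmodType R.

Lemma fixed_submodule : is_submodule (fun x : V => e *: x = x).
Proof.
split=> [|a u v eu ev]; first by rewrite scaler0.
by rewrite scalerDr scalerA mulrC -scalerA eu ev.
Qed.

(** The submodule e V, on which A acts through any lift along pi. *)
Definition cut & ring_factor pi e : Type :=
  submodule_type (submodule_of fixed_submodule).
HB.instance Definition _ := GRing.Zmodule.on (cut factor).

Definition cut_val (x : cut factor) : V := val x.

Lemma cut_valP x : e *: cut_val x = cut_val x.
Proof. by apply/(in_submodule_of fixed_submodule)/(valP x). Qed.

Lemma cut_val_inj : injective cut_val.
Proof. exact: val_inj. Qed.

Lemma cut_valD x y : cut_val (x + y) = cut_val x + cut_val y.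
Proof. by []. Qed.

Lemma cut_val0 : cut_val 0 = 0.
Proof. by []. Qed.

Lemma cut_exists (x : V) : e *: x = x -> exists y, cut_val y = x.
Proof.
move=> /(in_submodule_of fixed_submodule) xe.
by exists (exist _ x xe).
Qed.

Definition cut_scale (a : A) (x : cut factor) : cut factor :=
  (factor_lift a *: (x : submodule_type (submodule_of fixed_submodule))).

Lemma cut_val_scale a x : cut_val (cut_scale a x) = factor_lift a *: cut_val x.
Proof. by []. Qed.

Lemma cut_scaleA a b x : cut_scale a (cut_scale b x) = cut_scale (a * b) x.
Proof.
apply: cut_val_inj; rewrite !cut_val_scale scalerA.
by apply: factor_actE; rewrite ?cut_valP // rmorphM !factor_liftK.
Qed.
Lemma cut_scale1 : left_id 1 cut_scale.
Proof.
move=> x; apply: cut_val_inj; rewrite !cut_val_scale -[RHS]scale1r.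
by apply: factor_actE; rewrite ?cut_valP // rmorph1 !factor_liftK.
Qed.
Lemma cut_scaleDr : right_distributive cut_scale +%R.
Proof.
by move=> a x y; apply: cut_val_inj; rewrite cut_valD !cut_val_scale scalerDr.
Qed.
Lemma cut_scaleDl x : {morph cut_scale^~ x : a b / a + b}.
Proof.
move=> a b; apply: cut_val_inj; rewrite cut_valD !cut_val_scale -scalerDl.
by apply: factor_actE; rewrite ?cut_valP // rmorphD !factor_liftK.
Qed.

HB.instance Definition _ := GRing.Zmodule_isLmodule.Build A (cut factor)
  cut_scaleA cut_scale1 cut_scaleDr cut_scaleDl.

Lemma cut_valZ (r : R) (x : cut factor) : cut_val (pi r *: x) = r *: cut_val x.
Proof.
by rewrite cut_val_scale; apply: factor_actE; rewrite ?cut_valP ?factor_liftK.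
Qed.

Lemma cut_proj_exists :
  exists p : V -> cut factor, forall x, cut_val (p x) = e *: x.
Proof.
have /choice[p pE] : forall x : V, exists y : cut factor, cut_val y = e *: x.
  by move=> x; apply: cut_exists; rewrite scalerA factor_idem.
by exists p.
Qed.

End Cut.

Lemma factor_scaleP (a : A) : exists r, a = pi r.
Proof. by exists (factor_lift a); rewrite factor_liftK. Qed.

Lemma restriction_fixed (M : lmodType A) (x : restriction M pi) : e *: x = x.
Proof. by case: factor => _ pi_e _; rewrite restriction_scaleE pi_e scale1r. Qed.

Lemma linear_factor (M N : lmodType A) (g : M -> N) :
  (forall (r : R) x y, g (pi r *: x + y) = pi r *: g x + g y) ->
  exists f : {linear M -> N}, f =1 g.
Proof.
move=> gP; apply: linear_exists => a x y.
by have [r ->] := factor_scaleP a.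
Qed.

(** Cutting is right adjoint to restriction of scalars, which is exact. *)
Lemma cut_injective (V : lmodType R) :
  injective_module V -> injective_module (cut V factor).
Proof.
move=> injV N M i f inj_i.
have [|z [n [/esym i0 ->]]|g gP] := @injective_extension _ V (restriction M pi)
    (fun x z => exists n, x = i n /\ z = cut_val (f n)) injV.
- split=> [|a _ _ _ _ [n [-> ->]] [n' [-> ->]]].
    by exists 0; rewrite !linear0.
  exists (pi a *: n + n'); rewrite !linearD !linearZ restriction_scaleE; split=> //.
  by rewrite cut_valD cut_valZ.
- by rewrite -(linear0 i) in i0; rewrite (inj_i _ _ i0) linear0.
have /choice[h hg] : forall x, exists y : cut V factor, cut_val y = g x.
  by move=> x; apply: cut_exists; rewrite -linearZ /= restriction_fixed.
have [r x y|G Gh] := @linear_factor _ _ h.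
  by apply: cut_val_inj; rewrite cut_valD cut_valZ !hg -linearP.
exists G => n; apply: cut_val_inj; rewrite Gh hg; apply: gP.
by exists n.
Qed.

(** Cutting is also left adjoint to restriction of scalars, which preserves
    surjections. *)
Lemma cut_projective (V : lmodType R) :
  projective_module V -> projective_module (cut V factor).
Proof.
move=> projV M N p f p_onto; have [q qP] := cut_proj_exists V.
have qZ (a : R) x y : q (a *: x + y) = pi a *: q x + q y.
  apply: cut_val_inj; rewrite cut_valD cut_valZ !qP scalerDr !scalerA.
  by rewrite [e * a]mulrC.
have [r x y|p' p'E] := @linear_exists R (restriction M pi) (restriction N pi) p.
  exact: linearP.
have [r x y|f' f'E] := @linear_exists R V (restriction N pi) (f \o q).
  by rewrite /= qZ linearP.
have [y|g gP] := projV (restriction M pi) (restriction N pi) p' f'.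
  by have [x <-] := p_onto y; exists x.
have [r x y|G GE] := @linear_factor _ _ (g \o @cut_val V).
  by rewrite /= cut_valD cut_valZ linearP.
exists G => x; rewrite GE -p'E gP f'E /=; congr (f _).
by apply: cut_val_inj; rewrite qP cut_valP.
Qed.

(** Restriction of scalars is left adjoint to cutting, which preserves
    surjections. *)
Lemma restriction_projective (P : lmodType A) :
  projective_module P -> projective_module (restriction P pi).
Proof.
move=> projP M N p f p_onto.
have /choice[p' p'E] : forall x : cut M factor, exists y : cut N factor,
    cut_val y = p (cut_val x).
  by move=> x; apply: cut_exists; rewrite -linearZ /= cut_valP.
have /choice[f' f'E] : forall x : P, exists y : cut N factor, cut_val y = f x.
  by move=> x; apply: cut_exists; rewrite -linearZ /= restriction_fixed.
have [r x y|p2 p2E] := @linear_factor _ _ p'.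
  by apply: cut_val_inj; rewrite cut_valD cut_valZ !p'E cut_valD cut_valZ linearP.
have [r x y|f2 f2E] := @linear_factor _ _ f'.
  by apply: cut_val_inj; rewrite cut_valD cut_valZ !f'E -linearP.
have [y|g gP] := projP _ _ p2 f2.
  have [x xy] := p_onto (cut_val y); have [q qP] := cut_proj_exists M.
  by exists (q x); apply: cut_val_inj; rewrite p2E p'E qP linearZ /= xy cut_valP.
have [r x y|G GE] := @linear_exists R (restriction P pi) M (@cut_val M \o g).
  by rewrite /= restriction_scaleE linearP cut_valD cut_valZ.
by exists G => x; rewrite GE /= -p'E -p2E gP f2E f'E.
Qed.

End Factor.

Section FactorIdeals.
Variables (R A : comPzRingType) (pi : {rmorphism R -> A}) (e : R).
Hypothesis factor : ring_factor pi e.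

Lemma preimage_submodule (I : ideal A) : is_submodule (fun r : R^o => pi r \in I).
Proof.
split=> [|a u v Iu Iv]; first by rewrite rmorph0 ideal0.
by rewrite rmorphD rmorphM idealD ?idealM.
Qed.

Definition preimage_ideal (I : ideal A) : ideal R :=
  ideal_of (preimage_submodule I).

Lemma in_preimage_ideal (I : ideal A) (r : R) :
  (r \in preimage_ideal I) = (pi r \in I).
Proof. by apply/idP/idP => /(in_ideal_of (preimage_submodule I)). Qed.

Lemma factor_noetherian : noetherian R -> noetherian A.
Proof.
move=> noethR I incI.
have [n r|n nP] := noethR (fun n => preimage_ideal (I n)).
  by rewrite !in_preimage_ideal; apply: incI.
exists n => m le_nm a; have [r ->] := factor_scaleP factor a.
by have := nP m le_nm r; rewrite !in_preimage_ideal.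
Qed.

Lemma preimage_prime (P : ideal A) :
  prime_ideal P -> prime_ideal (preimage_ideal P) /\ e \notin preimage_ideal P.
Proof.
case: factor => _ pi_e _ [P1 PP]; split; last by rewrite in_preimage_ideal pi_e.
split=> [|a b]; first by rewrite in_preimage_ideal rmorph1.
by rewrite !in_preimage_ideal rmorphM; apply: PP.
Qed.

Lemma preimage_maximal (m : ideal A) :
  maximal_ideal m -> maximal_ideal (preimage_ideal m).
Proof.
move=> maxm; split=> [/(_ 1)|J smJ].
  by rewrite in_preimage_ideal rmorph1; apply/negP/maximal_ideal_N1.
have [sJm|] := pselect {subset J <= preimage_ideal m}.
  by left=> r; apply/idP/idP => [/sJm|/smJ].
move=> nsJm; right; apply: ideal_full.
have [r [Jr]] : exists r, r \in J /\ r \notin preimage_ideal m.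
  apply: contrapT => noR; apply: nsJm => r Jr; apply: contrapT => /negP rm.
  by apply: noR; exists r.
rewrite in_preimage_ideal => /(maximal_ideal_inverse maxm)[b].
have [s ->] := factor_scaleP factor b.
rewrite -rmorphM -(rmorph1 pi) -rmorphB -in_preimage_ideal => /smJ J1.
by rewrite -(subrK (s * r) 1) idealD ?idealM.
Qed.

End FactorIdeals.

(** * Small factors receive no maps from injective modules *)

(** If h did not vanish on e M, then M would have a maximal submodule L which
    does not contain e M, because the image of h is Noetherian. For x in e M
    outside L, the map b |-> b x extends from B to the hull E of B; the
    preimage of L in E is proper, and adding B to it gives E. *)
Lemma small_factor_map0 (R B : comPzRingType) (pi : {rmorphism R -> B}) (e : R)
    (M : lmodType R) (I : ideal R) (h : {linear M -> quotmod I}) :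
  noetherian R -> ring_factor pi e -> small_ring B -> injective_module M ->
  forall x, h (e *: x) = 0.
Proof.
move=> noethR factor [E [i [[inj_i _ _] smallE]]] injM x0.
apply: contrapT => hx0; have [onto_pi pi_e ker_pi] := factor.
have eex (x : M) : e *: (e *: x) = e *: x by rewrite scalerA (factor_idem factor).
pose L (J : ideal R) (x : M) :=
  exists r, r \in J /\ quotmod_proj I r = h (e *: x).
have [|J [[sIJ [x1 Lx1]] maxJ]] := @noetherian_maximal R
    (fun J => {subset I <= J} /\ exists x, ~ L J x) noethR.
  exists I; split=> //; exists x0 => -[r [Ir rE]]; apply: hx0.
  by rewrite -rE -(linear0 (quotmod_proj I)); apply/quotmod_projP; rewrite subr0.
pose x := e *: x1.
have Lx : ~ L J x by rewrite /L eex.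
have subL : is_submodule (L J).
  split=> [|a u v [r [Jr rE]] [s [Js sE]]].
    by exists 0; rewrite ideal0 scaler0 !linear0.
  exists (a *: (r : R^o) + s); split; first by rewrite idealD ?idealM.
  by rewrite linearP /= rE sE -linearP scalerDr !scalerA mulrC.
have [L0 LP] := subL.
(* J was chosen maximal so that L J is a maximal submodule of M *)
have Lmax u : exists c : R, L J (u - c *: x).
  have [rx rxE] := quotmod_proj_surj (h (e *: x)).
  have subJ' : is_submodule (fun r : R^o => exists c : R, r - c *: rx \in J).
    split=> [|a r s [c Jr] [d Js]].
      by exists 0; rewrite scale0r subr0 ideal0.
    exists (a * c + d); rewrite scalerDl -scalerA opprD addrACA -scalerBr.
    by rewrite idealD ?idealM.
  have [r [/in_ideal_of[c Jrc] rE]] : L (ideal_of subJ') u.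
    apply: contrapT => Lu; apply: Lx; exists rx; split=> //.
    apply: (maxJ (ideal_of subJ')).
    - split; last by exists u.
      by move=> r /sIJ Jr; apply/in_ideal_of; exists 0; rewrite scale0r subr0.
    - by move=> r Jr; apply/in_ideal_of; exists 0; rewrite scale0r subr0.
    - by apply/in_ideal_of; exists 1; rewrite scale1r subrr ideal0.
  exists c, (r - c *: rx); split=> //.
  rewrite linearB linearZ /= rxE rE scalerBr linearB; congr (_ - _).
  by rewrite [in RHS]scale_commute [RHS]linearZ.
have [||k kP] := @injective_extension _ M (restriction E pi)
    (fun u z => exists r : R, u = i (pi r) /\ z = r *: x) injM.
- split=> [|a _ _ _ _ [r [-> ->]] [s [-> ->]]].
    by exists 0; rewrite rmorph0 scale0r linear0.
  exists (a * r + s); rewrite scalerDl scalerA; split=> //.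
  by rewrite restriction_scaleE -linearP rmorphD rmorphM.
- move=> _ [r [/esym + ->]]; rewrite -(linear0 i) => /inj_i /ker_pi er0.
  by rewrite /x scalerA mulrC er0 scale0r.
have ki r : k (i (pi r)) = r *: x by apply: kP; exists r.
have subK : is_submodule (fun u : E => L J (k u)).
  split=> [|a u v Lu Lv]; first by rewrite linear0.
  have [r ->] := factor_scaleP factor a.
  by rewrite -[pi r *: u](restriction_scaleE r) linearP; apply: LP.
apply: (smallE (submodule_of subK)) => [/(_ (i 1))/in_submodule_of|u].
  by rewrite -(rmorph1 pi) ki scale1r.
have [c Lc] := Lmax (k u).
exists (i (pi c)), (u - i (pi c)); split.
- by apply/asboolP; exists (pi c).
- by apply/in_submodule_of; rewrite linearB ki.
- by rewrite addrC subrK.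
Qed.

(** * Simple ideals of a max-QF ring *)

Lemma projective_regular (R : pzRingType) : projective_module R^o.
Proof.
move=> M N p f p_onto; have [m mE] := p_onto (f 1).
have [a x y|g gE] := @linear_exists R R^o M (fun r => (r : R) *: m).
  by rewrite scalerDl scalerA.
by exists g => r; rewrite gE linearZ mE -linearZ /GRing.scale /= mulr1.
Qed.

Lemma projective_retract (R : pzRingType) (E Q : lmodType R)
    (i : {linear E -> Q}) (p : {linear Q -> E}) :
  projective_module Q -> cancel i p -> projective_module E.
Proof.
move=> projQ ipK M N q f q_onto.
have [g gP] := projQ M N q (f \o p) q_onto.
by exists (g \o i) => x /=; rewrite gP /= ipK.
Qed.

(** The map from E to R/m to be lifted is multiplication by s: its image is
    killed by m, hence contained in the socle R y of E, and it maps z to y for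
    any z such that s z = y. A lifting g has g z = 1 modulo m, so that
    g y = s (g z) = s is nonzero and g is injective by essentiality. *)
Lemma simple_ideal_hull (R : comPzRingType) (m : ideal R) (s : R) :
  max_QF R -> maximal_ideal m -> s != 0 -> (forall a, a \in m -> s * a = 0) ->
  exists (E : lmodType R) (y : E)
    (g : {linear E -> R^o}) (r : {linear R^o -> E}),
    [/\ injective_module E, socle_generator y, annihilator y =i m, g y = s
      & cancel g r].
Proof.
move=> maxQF maxm sN0 sm.
have [E [i [inj_i injE essE]]] := exists_injective_hull (quotmod m).
pose one : quotmod m := quotmod_proj m (1 : R^o).
pose y := i one.
have projE (c : R) : quotmod_proj m (c : R^o) = c *: one.
  by rewrite -linearZ /GRing.scale /= mulr1.
have iE (c : R) : i (quotmod_proj m c) = c *: y by rewrite projE linearZ.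
have annE (c : R) : (c \in m) = (c *: y == 0).
  rewrite -iE -(linear0 i) (inj_eq inj_i) -(linear0 (quotmod_proj m)).
  apply/idP/eqP => [cm|/quotmod_projP]; last by rewrite subr0.
  by apply/quotmod_projP; rewrite subr0.
have yN0 : y != 0 by rewrite -[y]scale1r -annE maximal_ideal_N1.
have inv_m (a : R) (M : lmodType R) (x : M) :
    (forall c, c \in m -> c *: x = 0) -> a \notin m -> exists b, x = b *: (a *: x).
  move=> mx /(maximal_ideal_inverse maxm)[b /mx].
  rewrite scalerBl scale1r -scalerA => /eqP; rewrite subr_eq0 => /eqP xE.
  by exists b.
have soc_y : socle_generator y.
  split=> // x xN0; apply: contrapT => noa.
  have subL : is_submodule (fun z => exists a : R, z = a *: x).
    split=> [|a _ _ [b ->] [c ->]]; first by exists 0; rewrite scale0r.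
    by exists (a * b + c); rewrite scalerDl scalerA.
  suff x0 : x = 0 by rewrite x0 eqxx in xN0.
  apply: (essE (submodule_of subL)); last first.
    by apply/in_submodule_of; exists 1; rewrite scale1r.
  move=> _ /asboolP[q <-] /in_submodule_of[a ax].
  have [c cq] := quotmod_proj_surj q; rewrite -cq iE in ax *.
  apply/eqP; rewrite -annE; apply: contrapT => /negP cNm; apply: noa.
  have [|b yE] := inv_m c E y _ cNm; first by move=> d; rewrite annE => /eqP.
  by exists (b * a); rewrite -scalerA -ax -yE.
have sm' (c : R) : c * s = 0 -> c \in m.
  move=> cs0; apply: contrapT => /negP cNm.
  have [|b] := inv_m c R^o (s : R^o) _ cNm.
    by move=> d /sm; rewrite mulrC.
  by rewrite -[c *: _]/(c * s) cs0 scaler0 => s0; rewrite s0 eqxx in sN0.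
have [||z zP] := injective_Baer injE
    (T := fun u w => exists r : R, u = r * s /\ w = r *: y).
- split=> [|a _ _ _ _ [b [-> ->]] [c [-> ->]]].
    by exists 0; rewrite mul0r scale0r.
  exists (a * b + c); rewrite mulrDl -mulrA.
  by split; rewrite // scalerDl scalerA.
- by move=> _ [r [/esym/sm' + ->]]; rewrite annE => /eqP.
have sz : s *: z = y by apply/esym/zP; exists 1; rewrite mul1r scale1r.
have [a u v|sE sEE] := @linear_exists R E E (fun x => s *: x).
  by rewrite scalerDr !scalerA mulrC.
have [x|f fE] := linear_lift (h := sE) inj_i.
  rewrite sEE; have [->|sxN0] := eqVneq (s *: x) 0.
    by exists 0; rewrite linear0.
  have [_ /(_ _ sxN0)[a asx]] := soc_y.
  have [||b sxE] := inv_m a E (s *: x).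
  - by move=> c /sm sc0; rewrite scalerA mulrC sc0 scale0r.
  - apply/negP => /sm sa0; move: yN0; rewrite -asx scalerA mulrC sa0.
    by rewrite scale0r eqxx.
  by exists (quotmod_proj m b); rewrite iE sxE asx.
have [g gE] := maxQF E injE m maxm f.
have gy : g y = s.
  have /quotmod_projP/sm : quotmod_proj m (g z) = quotmod_proj m (1 : R^o).
    by apply: inj_i; rewrite gE fE sEE sz.
  by rewrite mulrBr mulr1 => /eqP; rewrite subr_eq0 -sz linearZ => /eqP.
have inj_g : injective g.
  apply: raddf_inj => x gx0; apply: contrapT => /eqP xN0.
  have [_ /(_ _ xN0)[a ax]] := soc_y.
  by move: sN0; rewrite -gy -ax linearZ /= gx0 scaler0 eqxx.
have [r rP] := injE E R^o g idfun inj_g.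
exists E, y, g, r; split=> // c.
by rewrite in_annihilator annE.
Qed.

(** An idempotent e is socular when all primes of the factor e R are maximal
    and associated to R. *)
Definition socular_idempotent (R : comPzRingType) (e : R) :=
  e * e = e /\ forall P : ideal R, prime_ideal P -> e \notin P ->
    maximal_ideal P /\ exists2 s : R, s != 0 & forall a, a \in P -> s * a = 0.

Lemma socular_idempotentU (R : comPzRingType) (e f : R) :
  socular_idempotent e -> socular_idempotent f ->
  [/\ socular_idempotent (e + f - e * f), (e + f - e * f) * e = e
    & (e + f - e * f) * f = f].
Proof.
move=> [ee soce] [ff socf].
have ue : (e + f - e * f) * e = e.
  have efe : e * f * e = f * e by rewrite mulrAC ee mulrC.
  by rewrite mulrBl mulrDl ee efe addrK.
have uf : (e + f - e * f) * f = f.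
  by rewrite mulrBl mulrDl ff -mulrA ff addrC addKr.
split=> //; split.
  by rewrite {2}[e + f - e * f]addrAC mulrDr mulrBr ue mulrA ue uf addrAC.
move=> P primeP uP; have [eP|] := boolP (e \in P); last exact: soce.
have [fP|] := boolP (f \in P); last exact: socf.
by case/negP: uP; rewrite idealB ?idealD ?idealM.
Qed.

Lemma prime_ideal_exp (R : comPzRingType) (P : ideal R) (a : R) n :
  prime_ideal P -> a ^+ n \in P -> a \in P.
Proof.
move=> [P1 PP]; elim: n => [|n IHn]; first by rewrite expr0 (negbTE P1).
by rewrite exprS => /PP[].
Qed.

(** The hull E of R/m is a summand of R; let z be the image of 1 in E and e the
    idempotent which generates E inside R. For a in m, the annihilators of the
    a^n z stabilize at some n. If a^n z were nonzero, then y = c a^n z for some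
    c, and c would annihilate a^(n+1) z, because a y = 0, but not a^n z. Hence a
    is nilpotent on e R, and a prime which does not contain e contains m. *)
Lemma simple_ideal_idempotent (R : comPzRingType) (m : ideal R) (s : R) :
  noetherian R -> max_QF R -> maximal_ideal m -> s != 0 ->
  (forall a, a \in m -> s * a = 0) ->
  exists2 e, socular_idempotent e & s * e = s.
Proof.
move=> noethR maxQF maxm sN0 sm.
have [E [y [g [r [injE [yN0 y_soc] annE gy rK]]]]] :=
  simple_ideal_hull maxQF maxm sN0 sm.
have rE (c : R) : r c = c *: r 1 by rewrite -linearZ /GRing.scale /= mulr1.
have gE (x : E) : (g x : R) * g (r 1) = g x by rewrite -[LHS]linearZ -rE rK.
exists (g (r 1)); last by rewrite -gy gE.
split; first exact: gE.
have nil a : a \in m -> exists n, a ^+ n * (g (r 1) : R) = 0.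
  move=> ma; have [n c|n nP] := noethR (fun n => annihilator (a ^+ n *: r 1)).
    rewrite !in_annihilator exprS => /eqP c0.
    by rewrite -scalerA scale_commute c0 scaler0.
  exists n; rewrite -[LHS]linearZ; apply: contrapT => gN0.
  have /y_soc[c cE] : a ^+ n *: r 1 != 0.
    by apply/eqP => an0; apply: gN0; rewrite an0 linear0.
  have := nP n.+1 (leqnSn n) c; rewrite !in_annihilator cE (negbTE yN0).
  rewrite exprS -scalerA scale_commute cE => /negP; apply.
  by rewrite -in_annihilator annE.
move=> P primeP eP; have [P1 PP] := primeP.
have smP : {subset m <= P}.
  move=> a /nil[n an0]; have /PP[|eP'] : a ^+ n * (g (r 1) : R) \in P.
  - by rewrite an0 ideal0.
  - exact: prime_ideal_exp.
  - by rewrite eP' in eP.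
have [mN maxm'] := maxm.
have Pm : P =i m by case: (maxm' P smP) => // Pfull; rewrite Pfull in P1.
split; last by exists s => // a; rewrite Pm; apply: sm.
split=> [Pfull|J sPJ]; first by rewrite Pfull in P1.
have [a /smP/sPJ //|Jm|Jfull] := maxm' J; last by right.
by left=> a; rewrite Jm Pm.
Qed.

(** If the annihilator of 1 - e, which is the ideal e R, is largest, then a
    simple ideal s R with s e = 0 would lie in f R for another such idempotent
    f, and e + f - e f would give a larger ideal. *)
Lemma maximal_socular_idempotent (R : comPzRingType) :
  noetherian R -> max_QF R ->
  exists2 e : R, socular_idempotent e &
    forall (m : ideal R) (s : R), maximal_ideal m ->
      (forall a, a \in m -> s * a = 0) -> s * e = 0 -> s = 0.
Proof.
move=> noethR maxQF.
have [|_ [[e [soce ->]] maxe]] := @noetherian_maximal R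
    (fun J => exists e : R,
       socular_idempotent e /\ J = annihilator (1 - e : R^o)) noethR.
  exists (annihilator (1 - 0 : R^o)), 0; split=> //.
  by split=> [|P _ /negP[]]; rewrite ?mulr0 ?ideal0.
exists e => // m s maxm sm se0; apply: contrapT => /eqP sN0.
have [f socf sf] := simple_ideal_idempotent noethR maxQF maxm sN0 sm.
have [socu ue uf] := socular_idempotentU soce socf.
set u := e + f - e * f in socu ue uf.
have inE (x c : R) : (c \in annihilator (1 - x : R^o)) = (x * c == c).
  rewrite in_annihilator -[c *: _]/(c * (1 - x)) mulrBr mulr1 subr_eq0 eq_sym.
  by rewrite mulrC.
have : f \in annihilator (1 - e : R^o).
  apply: (maxe (annihilator (1 - u : R^o))); first by exists u.
  - by move=> c; rewrite !inE => /eqP ec; rewrite -ec mulrA ue.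
  - by rewrite inE uf.
rewrite inE => /eqP ef.
by move: sN0; rewrite -sf -ef mulrA se0 mul0r eqxx.
Qed.

(** * Splitting off the corner ring of an idempotent *)

Section Corner.
Variables (R : comPzRingType) (e : R).
Hypothesis idem : e * e = e.

Lemma corner_submodule : is_submodule (fun x : R^o => e * (x : R) = x).
Proof.
split=> [|a u v eu ev]; first by rewrite mulr0.
by rewrite mulrDr ev -[a *: u]/(a * u) mulrCA eu.
Qed.

Definition corner & e * e = e : Type :=
  submodule_type (ideal_of corner_submodule).
HB.instance Definition _ := GRing.Zmodule.on (corner idem).

Definition corner_val (x : corner idem) : R := val x.

Lemma corner_valP x : e * corner_val x = corner_val x.
Proof. by apply/(in_ideal_of corner_submodule)/(valP x). Qed.

Lemma corner_val_inj : injective corner_val.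
Proof. exact: val_inj. Qed.

Definition corner_sub (x : R) (ex : e * x = x) : corner idem :=
  exist _ (x : R^o) (proj2 (in_ideal_of corner_submodule x) ex).

Lemma corner_proj_subproof x : e * (e * x) = e * x.
Proof. by rewrite mulrA idem. Qed.
Definition corner_proj x : corner idem := corner_sub (corner_proj_subproof x).

Lemma corner_mul_subproof (x y : corner idem) :
  e * (corner_val x * corner_val y) = corner_val x * corner_val y.
Proof. by rewrite mulrA corner_valP. Qed.
Definition corner_mul x y : corner idem := corner_sub (corner_mul_subproof x y).

Definition corner_one : corner idem := corner_sub idem.

Lemma corner_mulA : associative corner_mul.
Proof. by move=> x y z; apply: corner_val_inj; rewrite /corner_val /= mulrA. Qed.
Lemma corner_mulC : commutative corner_mul.
Proof. by move=> x y; apply: corner_val_inj; rewrite /corner_val /= mulrC. Qed.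
Lemma corner_mul1 : left_id corner_one corner_mul.
Proof. by move=> x; apply: corner_val_inj; apply: corner_valP. Qed.
Lemma corner_mulDl : left_distributive corner_mul +%R.
Proof. by move=> x y z; apply: corner_val_inj; rewrite /corner_val /= mulrDl. Qed.

HB.instance Definition _ := GRing.Zmodule_isComPzRing.Build (corner idem)
  corner_mulA corner_mulC corner_mul1 corner_mulDl.

Lemma corner_projB : {morph corner_proj : x y / x - y}.
Proof. by move=> x y; apply: corner_val_inj; rewrite /corner_val /= mulrBr. Qed.
Lemma corner_projM : {morph corner_proj : x y / x * y}.
Proof.
by move=> x y; apply: corner_val_inj; rewrite /corner_val /= mulrACA idem.
Qed.
Lemma corner_proj1 : corner_proj 1 = 1.
Proof. by apply: corner_val_inj; rewrite /corner_val /= mulr1. Qed.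

HB.instance Definition _ :=
  GRing.isZmodMorphism.Build R (corner idem) corner_proj corner_projB.
HB.instance Definition _ :=
  GRing.isMonoidMorphism.Build R (corner idem) corner_proj
    (conj corner_proj1 corner_projM).

Lemma corner_factor : ring_factor corner_proj e.
Proof.
split=> [x||x /(congr1 corner_val) //].
- by exists (corner_val x); apply: corner_val_inj; apply: corner_valP.
- by apply: corner_val_inj; apply: idem.
Qed.

End Corner.

(** * The equivalence *)

(** The hulls of the simple ideals of R which lie in e R are projective, being
    summands of R; cut by e, they provide the modules asked by the criterion. *)
Lemma quasi_Frobenius_factor (R A : comPzRingType) (pi : {rmorphism R -> A})
    (e : R) :
  noetherian R -> max_QF R -> ring_factor pi e -> socular_idempotent e ->
  quasi_Frobenius A.
Proof.
move=> noethR maxQF factor [_ soce].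
apply: QF_criterion => [|P /(preimage_prime factor)[primeP eP]].
  exact: factor_noetherian factor noethR.
have [maxP [s sN0 sP]] := soce _ primeP eP.
have [E [y [g [r [injE [yN0 y_soc] annE gy rK]]]]] :=
  simple_ideal_hull maxQF maxP sN0 sP.
have [_ pi_e _] := factor.
have ey : e *: y = y.
  apply/eqP; rewrite -subr_eq0 -{2}[y]scale1r -scalerBl -in_annihilator annE.
  by rewrite in_preimage_ideal rmorphB pi_e rmorph1 subrr ideal0.
have [y' y'E] := cut_exists factor ey.
have y'Z (c : R) : (pi c *: y' == 0) = (c *: y == 0).
  by rewrite -(inj_eq (@cut_val_inj _ _ _ _ factor E)) cut_valZ y'E.
exists (cut E factor), y'; split.
- exact: cut_injective.
- exact/cut_projective/(projective_retract (@projective_regular R) rK).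
- split=> [|x xN0].
    by rewrite -[y']scale1r -(rmorph1 pi) y'Z scale1r.
  have /y_soc[c cx] : cut_val x != 0.
    by rewrite -(cut_val0 factor) (inj_eq (@cut_val_inj _ _ _ _ factor E)).
  by exists (pi c); apply: cut_val_inj; rewrite cut_valZ cx.
- move=> a; have [c ->] := factor_scaleP factor a.
  by rewrite in_annihilator y'Z -in_annihilator annE in_preimage_ideal.
Qed.

Lemma small_ring_factor (R B : comPzRingType) (pi : {rmorphism R -> B}) (e : R) :
  noetherian R -> ring_factor pi e ->
  (forall (m : ideal R) (s : R), maximal_ideal m ->
      (forall a, a \in m -> s * a = 0) -> e * s = s -> s = 0) ->
  small_ring B.
Proof.
move=> noethR factor no_socle; have [_ pi_e ker_pi] := factor.
apply: small_criterion => [|m maxm t tm].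
  exact: factor_noetherian factor noethR.
have [s sE] := factor_scaleP factor t.
have idem : e * (e * s) = e * s by rewrite mulrA (factor_idem factor).
have piE : pi (e * s) = t by rewrite rmorphM pi_e mul1r.
rewrite -piE [e * s](no_socle _ _ (preimage_maximal factor maxm)) ?rmorph0 //.
move=> a; rewrite in_preimage_ideal => /tm ta0.
by rewrite -idem -mulrA ker_pi // rmorphM piE.
Qed.

Lemma max_QF_decomposition (R : comPzRingType) :
  noetherian R -> max_QF R ->
  exists (A B : comPzRingType) (f : {rmorphism R -> A * B}),
    [/\ bijective f, quasi_Frobenius A & small_ring B].
Proof.
move=> noethR maxQF.
have [e soce no_socle] := maximal_socular_idempotent noethR maxQF.
have [idem _] := soce.
have e1e : e * (1 - e) = 0 by rewrite mulrBr mulr1 idem subrr.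
have idem1 : (1 - e) * (1 - e) = 1 - e by rewrite {1}mulrBl e1e mul1r subr0.
pose A : comPzRingType := corner idem; pose B : comPzRingType := corner idem1.
pose f (x : R) : A * B := (corner_proj idem x, corner_proj idem1 x).
have fB : zmod_morphism f by move=> x y; rewrite /f !rmorphB.
have fM : monoid_morphism f.
  by split=> [|x y]; rewrite /f ?rmorph1 ?rmorphM.
pose F : {rmorphism R -> A * B} := HB.pack f
  (GRing.isZmodMorphism.Build R (A * B)%type f fB)
  (GRing.isMonoidMorphism.Build R (A * B)%type f fM).
exists A, B, F; split.
- exists (fun w => corner_val w.1 + corner_val w.2) => [x|[x y]].
    by rewrite /corner_val /= mulrBl mul1r addrC subrK.
  congr pair; apply: corner_val_inj; rewrite /corner_val /= mulrDr.
    rewrite -[val y](corner_valP y) -[val x](corner_valP x) !mulrA.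
    by rewrite idem e1e mul0r addr0.
  rewrite -[val y](corner_valP y) -[val x](corner_valP x) !mulrA.
  by rewrite idem1 [(1 - e) * e]mulrC e1e mul0r add0r.
- exact: quasi_Frobenius_factor noethR maxQF (corner_factor idem) soce.
- apply: small_ring_factor noethR (corner_factor idem1) _ => m s maxm sm es.
  by apply: no_socle maxm sm _; rewrite -es mulrC mulrA e1e mul0r.
Qed.

Lemma decomposition_almost_QF (R A B : comPzRingType)
    (f : {rmorphism R -> A * B}) :
  noetherian R -> bijective f -> quasi_Frobenius A -> small_ring B ->
  almost_QF R.
Proof.
move=> noethR bij_f QFA smallB M injM I h.
have inj_f := bij_inj bij_f; have [f' _ f'K] := bij_f.
pose e := f' (1, 0); pose e' := f' (0, 1).
have factorA : ring_factor (fst \o f) e.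
  split=> [a||r /= fr0]; first by exists (f' (a, 0)); rewrite /= f'K.
  - by rewrite /= f'K.
  - apply: inj_f; rewrite rmorphM f'K rmorph0.
    by congr pair; rewrite /= ?fr0 ?mulr0 ?mul0r.
have factorB : ring_factor (snd \o f) e'.
  split=> [b||r /= fr0]; first by exists (f' (0, b)); rewrite /= f'K.
  - by rewrite /= f'K.
  - apply: inj_f; rewrite rmorphM f'K rmorph0.
    by congr pair; rewrite /= ?fr0 ?mulr0 ?mul0r.
have ee' : e + e' = 1.
  apply: inj_f; rewrite rmorphD !f'K rmorph1.
  by congr pair; rewrite /= ?add0r ?addr0.
have he x : h (e *: x) = h x.
  have he'0 := small_factor_map0 h noethR factorB smallB injM x.
  by rewrite -[in RHS](scale1r x) -ee' scalerDl linearD he'0 addr0.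
pose C : lmodType R := restriction (cut M factorA) (fst \o f).
have projC : projective_module C.
  by apply: (restriction_projective factorA); apply: QFA; apply: cut_injective.
have [r x y|h' h'E] := @linear_exists R C (quotmod I)
    (fun w : cut M factorA => h (cut_val w)).
  by rewrite restriction_scaleE cut_valD cut_valZ linearP.
have [y|g gP] := projC R^o (quotmod I) (quotmod_proj I) h'.
  exact: quotmod_proj_surj.
have [q qE] := cut_proj_exists factorA M.
have [r x y|G GE] := @linear_exists R M R^o (fun x => g (q x)).
  rewrite -linearP; congr (g _); apply: cut_val_inj.
  by rewrite restriction_scaleE cut_valD cut_valZ !qE scalerDr scale_commute.
by exists G => x; rewrite GE gP h'E qE he.
Qed.

Theorem theorem3 (R : comPzRingType) (noethR : noetherian R) :
  [<-> almost_QF R;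
       max_QF R;
       exists (A B : comPzRingType) (f : {rmorphism R -> A * B}),
         [/\ bijective f, quasi_Frobenius A & small_ring B]].
Proof.
tfae.
- by move=> QF M injM I _; apply: QF.
- exact: max_QF_decomposition.
- case=> A [B [f [bij_f QFA smallB]]].
  exact: decomposition_almost_QF bij_f QFA smallB.
Qed.
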